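(* Let $F$ be an unlabeled finite simple undirected graph. Then $F$ is isomorphic to the codegree prime graph $\Delta_{\mathrm{cod}}(G)$ of some finite solvable group $G$ if and only if its complement $\overline{F}$ is $3$-colorable and triangle-free.
   Context: For a finite group $G$, $\mathrm{Irr}(G)$ is the set of irreducible complex characters of $G$. For $\chi\in\mathrm{Irr}(G)$ the codegree of $\chi$ is $\mathrm{cod}(\chi)=|G:\ker(\chi)|/\chi(1)$, and $\mathrm{cod}(G)=\{\mathrm{cod}(\chi) : \chi\in\mathrm{Irr}(G)\}$. The codegree prime graph $\Delta_{\mathrm{cod}}(G)$ is the simple undirected graph whose vertices are the prime divisors of the numbers in $\mathrm{cod}(G)$, two distinct vertices $p,q$ being adjacent if and only if $pq$ divides some number in $\mathrm{cod}(G)$. *)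

(* Defs.v *)
From HB Require Import structures.
From mathcomp Require Import all_boot all_order all_fingroup all_algebra.
From mathcomp Require Import all_solvable all_field all_character.

Set Implicit Arguments.
Unset Strict Implicit.
Unset Printing Implicit Defensive.

Import Order.TTheory GroupScope GRing.Theory Num.Theory.
Local Open Scope ring_scope.

(* A simple graph on T is a symmetric irreflexive relation e : rel T. *)

Definition graph_iso (T U : Type) (e : rel T) (f : rel U) : Prop :=
  exists2 h : T -> U, bijective h & {mono h : x y / e x y >-> f x y}.

Definition complement (T : eqType) (e : rel T) : rel T :=
  [rel x y | (x != y) && ~~ e x y].

Definition colorable (k : nat) (T : Type) (e : rel T) : Prop :=
  exists c : T -> 'I_k, forall x y, e x y -> c x != c y.

Definition triangle_free (T : Type) (e : rel T) : Prop :=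
  forall x y z, ~~ [&& e x y, e y z & e x z].

Section Codegree.

Variables (gT : finGroupType) (G : {group gT}).

(* Computed in the field algC, where characters take their values. It is a   *)
(* natural number for irreducible chi (codegree_nat), so divisibility in     *)
(* algC, (_ %| _)%C, which means up to an integer factor, is the usual one.  *)
Definition codegree (chi : 'CF(G)) : algC :=
  #|G : cfker chi|%:R / chi 1%g.

Definition codegrees : seq algC := [seq codegree chi | chi <- irr G].

Definition cod_vertex (p : nat) : bool :=
  prime p && has (fun c => (p %| c)%C) codegrees.

Definition cod_graph : rel {p : nat | cod_vertex p} :=
  [rel p q | (val p != val q) &&
     has (fun c => ((val p * val q)%N %| c)%C) codegrees].

Lemma codegree_nat (i : Iirr G) : codegree 'chi_i \is a Num.nat.
Proof.
have nK := cfker_normal 'chi_i.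
have := dvd_irr1_cardG (quo_Iirr (cfker 'chi_i) i).
rewrite quo_IirrE // cfQuo1 // card_quotient ?normal_norm // => /dvdCP_nat.
case=> [||n def_n]; rewrite ?ler0n ?char1_ge0 ?irr_char //.
by rewrite /codegree [X in X / _]def_n mulfK ?irr1_neq0 // natr_nat.
Qed.

Lemma cod_graph_sym : symmetric cod_graph.
Proof. by move=> p q; rewrite /cod_graph /= [val p == _]eq_sym [(val p * _)%N]mulnC. Qed.

Lemma cod_graph_irr : irreflexive cod_graph.
Proof. by move=> p; rewrite /cod_graph /= eqxx. Qed.

End Codegree.

(* Main.v *)
Require Import Defs.
From mathcomp Require Import all_boot all_order all_fingroup all_algebra.
From mathcomp Require Import all_solvable all_field all_character.
From mathcomp Require Import ring.

(** Let [G] be solvable. If commuting elements [x] and [y] have distinct prime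
    orders [p] and [q], then [p] and [q] are adjacent in the codegree graph of
    [G] ([codegree_prime_orders]). The reason is that an irreducible character
    [chi] with [|G| / chi 1] prime to [p] vanishes at the elements of order
    divisible by [p] ([irr_vanish_defect0]): if [p * q] divided no codegree,
    [chi (x * y)] would be 0 for all [chi] with neither [x] nor [y] in the
    kernel, contrary to the orthogonality relations. So nonadjacent primes [p]
    and [q] satisfy [gk_nonadjacent]: no element has order [p * q]. The rest is
    group theory. Three primes cannot be pairwise nonadjacent, since a group
    with a normal [q]-subgroup on which elements of order [r] act without fixed
    points does not act in the same way on a [p]-group ([solvable_no_triangle]).
    Draw an arrow from [p] to [q] if [p] divides the order of the normaliser of
    a Sylow [q]-subgroup. Each nonadjacent pair has an arrow in one direction
    at least ([normalizes_Sylow_total]), and there is no path of three arrows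
    ([no_three_step_path]). Sources, inner vertices and sinks are therefore the
    classes of a 3-colouring of the complement.

    Conversely, let the complement of a graph be triangle-free, and coloured
    with 0, 1 and 2. Choose a prime [r t] for each vertex [t] such that [r u]
    is congruent to 1 modulo [r t] if [u] has a larger colour than [t]
    ([coloured_primes]). Let [C] be cyclic, its order being the product of the
    primes of colour 0. Extend [C] by a direct sum [V1] of modules, one over
    the field of order [r d] for each vertex [d] of colour 1, and extend
    [V1 ><| C] in the same way by [V2], with the vertices of colour 2. Each
    module is induced from a one-dimensional module of a normal subgroup [Y]
    with kernel [Z], where [Z] is also normal. On it, an element of prime order
    has no nonzero fixed point if and only if it is in [Y] but not in [Z]; so
    [Y] and [Z] can be chosen in such a way that elements of order [r t] have
    fixed points on the module of a vertex [u] of larger colour if and only if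
    [t] and [u] are adjacent. For the vertices of colour 2, triangle-freeness
    ensures that [Y / Z] is cyclic, so that the one-dimensional module exists
    ([ext2_exists]). Fixed points give commuting elements, hence edges; where
    there are none, Clifford theory shows that [r t * r u] divides no codegree
    ([normal_abelian_Sylow_codegree] and [prime_section_codegree]). *)

Set Implicit Arguments.
Unset Strict Implicit.
Unset Printing Implicit Defensive.

Import Order.TTheory GroupScope GRing.Theory Num.Theory.
Local Open Scope ring_scope.

(** * Divisibility of algebraic integers by the powers of a prime *)

(** The constant coefficient of the minimal polynomial of [z] is a nonzero
    multiple of [z], because no polynomial of smaller degree has the root [z]. *)
Lemma Aint_mul_Cint (z : algC) : z \in Aint -> z != 0 ->
  exists2 w, w \in Aint & (z * w \in Num.int) && (z * w != 0).
Proof.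
move=> Az nz_z; have [p [Dp mon_p] dv_p] := minCpolyP z.
have Zq := Az; rewrite /Aint unfold_in Dp in Zq.
set q := map_poly _ p in Zq.
have Dq : q = (q`_0)%:P + drop_poly 1 q * 'X.
  rewrite -{1}(poly_take_drop 1 q) expr1; congr (_ + _); apply/polyP=> -[|i];
  by rewrite coef_take_poly coefC.
have qz0 : z * - (drop_poly 1 q).[z] = q`_0.
  have := root_minCpoly z; rewrite Dp rootE -/q {1}Dq hornerD hornerC hornerMX.
  by rewrite addr_eq0 => /eqP->; rewrite mulrN mulrC.
exists (- (drop_poly 1 q).[z]).
  rewrite rpredN rpred_horner //; apply/polyOverP=> i; rewrite coef_drop_poly.
  by rewrite Aint_Cint ?(polyOverP Zq).
rewrite qz0 (polyOverP Zq) /=; apply/eqP=> q0.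
have Dd : drop_poly 1 q = map_poly ratr (drop_poly 1 p).
  by apply/polyP=> i; rewrite !(coef_map, coef_drop_poly).
move/eqP: qz0; rewrite q0 mulf_eq0 (negPf nz_z) oppr_eq0 Dd -rootE dv_p.
have sz_p : (1 < size p)%N by rewrite -(size_map_poly (@ratr algC)) -Dp size_minCpoly.
have nz_d : drop_poly 1 p != 0 by rewrite -size_poly_gt0 size_drop_poly subn_gt0.
move=> /(dvdp_leq nz_d); rewrite size_drop_poly subn1 leqNgt ltn_predL.
by rewrite (ltn_trans _ sz_p).
Qed.

(** If [z] were not 0, all the powers of [p] would divide the nonzero rational
    integer that [Aint_mul_Cint] provides among the multiples of [z]. *)
Lemma Aint_dvd_expn_eq0 (p : nat) (z : algC) : (1 < p)%N ->
  (forall b : nat, z / p%:R ^+ b \in Aint) -> z = 0.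
Proof.
move=> p_gt1 pz; have Az : z \in Aint by have := pz 0%N; rewrite expr0 divr1.
apply/eqP/negPn/negP=> /(Aint_mul_Cint Az)[w Aw /andP[/intrP[n Dn] nz_n]].
have p_neq0 b : p%:R ^+ b != 0 :> algC by rewrite expf_neq0 // pnatr_eq0 -lt0n ltnW.
have: (`|n| < p ^ `|n|)%N by apply: ltn_expl.
rewrite ltnNge => /negP[]; apply: dvdn_leq.
  by rewrite absz_gt0; apply: contraNneq nz_n => n0; rewrite Dn n0.
have Zn : z * w / p%:R ^+ `|n|%N \in Num.int.
  rewrite Cint_rat_Aint //; last by rewrite mulrAC rpredM.
  by rewrite Dn rpred_div ?rpredX ?Crat_rat ?rpred_nat ?rpred_int.
have /intrP[m Dm] := Zn.
have : n = m * (p ^ `|n|)%N%:Z.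
  apply: (intr_inj (R := algC)); rewrite rmorphM /= -Dm -Dn -pmulrn natrX.
  by rewrite divfK.
by move/(congr1 absz) => {2}->; rewrite abszM absz_nat dvdn_mull.
Qed.

(** The lengths of the orbits of [s] are powers of [p], and those of the orbits
    in [A] do not divide [p ^ b]; hence they are all multiples of [p ^ b.+1],
    and [F] is constant on each orbit. *)
Lemma sum_perm_dvdA (X : finType) (s : {perm X}) (A : {set X}) (p m b : nat)
    (F : X -> algC) :
  prime p -> (s ^+ (p ^ m) = 1)%g -> (forall x, (s x \in A) = (x \in A)) ->
  (forall x, F (s x) = F x) -> (forall x, F x \in Aint) ->
  (forall x, x \in A -> (s ^+ (p ^ b))%g x != x) ->
  (\sum_(x in A) F x) / p%:R ^+ b.+1 \in Aint.
Proof.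
move=> pr_p s1 sA sF AF moved.
have sXA i x : ((s ^+ i)%g x \in A) = (x \in A).
  by elim: i x => [|i IH] x; rewrite ?perm1 // expgS permM IH.
have sXF i x : F ((s ^+ i)%g x) = F x.
  by elim: i x => [|i IH] x; rewrite ?perm1 // expgS permM IH.
have orbE x : porbit s x = orbit 'P <[s]>%g x by rewrite porbit.unlock.
have dvd x : x \in A -> (p ^ b.+1 %| #|porbit s x|)%N.
  move=> Ax; have: (#|porbit s x| %| p ^ m)%N.
    rewrite orbE; apply: dvdn_trans (dvdn_orbit _ _ _) _.
    by rewrite -orderE order_dvdn s1.
  case/(dvdn_pfactor _ _ pr_p)=> j _ Dj; rewrite Dj dvdn_exp2l // ltnNge.
  apply: contra (moved x Ax) => le_jb; rewrite -(subnK le_jb) expnD mulnC expgM.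
  have fix_j : (s ^+ (p ^ j))%g x = x by rewrite permX -Dj iter_porbit.
  apply/eqP; elim: (p ^ (b - j))%N => [|n IH]; first by rewrite perm1.
  by rewrite expgS permM fix_j IH.
rewrite (partition_big (porbit s) (mem (porbits s))) => [|x _]; last exact: imset_f.
rewrite mulr_suml rpred_sum // => _ /imsetP[x _ ->].
have [Ax | A'x] := boolP (x \in A); last first.
  rewrite big_pred0 ?mul0r ?Aint0 // => y; apply: contraNF A'x => /andP[Ay].
  by rewrite eq_sym eq_porbit_mem => /porbitP[i ->]; rewrite sXA.
rewrite (eq_bigl (mem (porbit s x))) => [|y]; last first.
  rewrite eq_porbit_mem andb_idl // => /porbitP[i ->]; by rewrite sXA.
rewrite (eq_bigr (fun=> F x)) => [|_ /porbitP[i ->]]; last exact: sXF.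
rewrite sumr_const -[F x *+ _]mulr_natr -mulrA rpredM // -natrX.
have /dvdnP[k ->] := dvd x Ax; rewrite natrM mulfK ?rpred_nat //.
by rewrite pnatr_eq0 -lt0n expn_gt0 prime_gt0.
Qed.

(** * Vanishing of irreducible characters at p-singular elements *)

Section DefectZero.

Variables (gT : finGroupType) (G : {group gT}) (i : Iirr G).
Local Notation chi := 'chi_i.

(** This iterates the identity [chi * chi = (|G| / chi 1) chi] for the
    convolution product. *)
Lemma irr_convolution_tuple (k : nat) (c : gT) :
  \sum_(t : k.+1.-tuple gT | (\prod_(x <- t) x)%g == c) \prod_(x <- t) chi x
    = (#|G|%:R / chi 1%g) ^+ k * chi c.
Proof.
elim: k c => [|k IH] c.
  rewrite (big_pred1 [tuple c]) => [|t]; first by rewrite big_seq1 mul1r.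
  case/tupleP: t => x t; rewrite [t]tuple0 /= big_seq1.
  by apply/eqP/eqP=> [-> | [->]] //; apply/val_inj.
pose f (ht : gT * k.+1.-tuple gT) := [tuple of ht.1 :: ht.2].
pose f' (t : k.+2.-tuple gT) := (thead t, [tuple of behead t]).
rewrite (reindex f) /=; last first.
  exists f' => [[h t] _ | t _]; last by rewrite /f /f' /= -tuple_eta.
  by congr (_, _); apply: val_inj.
rewrite (eq_bigr (fun ht : gT * k.+1.-tuple gT => chi ht.1 * \prod_(x <- ht.2) chi x)) => [|ht _]; last first.
  by rewrite big_cons.
rewrite (eq_bigl (fun ht : gT * k.+1.-tuple gT => true && ((\prod_(x <- ht.2) x)%g == (ht.1^-1 * c)%g))) => [|ht]; last first.
  by rewrite big_cons -(inj_eq (mulgI (ht.1^-1)%g)) mulKg.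
rewrite -(pair_big_dep xpredT (fun h (t : k.+1.-tuple gT) => (\prod_(x <- t) x)%g == (h^-1 * c)%g) (fun h (t : k.+1.-tuple gT) => chi h * \prod_(x <- t) chi x)) /=.
under eq_bigr => h _ do rewrite -mulr_sumr IH mulrCA.
rewrite -mulr_sumr exprSr -mulrA; congr (_ * _).
have := generalized_orthogonality_relation c i i; rewrite eqxx mul1r => orth.
rewrite -mulrA [_^-1 * _]mulrC -orth mulVKf ?neq0CG // (bigID (mem G)) /= addrC big1 ?add0r => [|h nGh].
  rewrite (reindex_inj invg_inj) /=; apply: eq_big => [h | h _]; first by rewrite groupV.
  by rewrite invgK mulrC.
by rewrite cfun0 ?mul0r.
Qed.

End DefectZero.

(** A word that commutes with the word [u], and whose length is a multiple of
    the length of [u], is a power of [u]. *)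
Lemma prod_commuting_word (gT : finGroupType) (u v : seq gT) (e : nat) :
    size v = (size u * e)%N -> u ++ v = v ++ u ->
  (\prod_(x <- v) x)%g = ((\prod_(x <- u) x) ^+ e)%g.
Proof.
elim: e v => [|e IH] v.
  by rewrite muln0 => /size0nil-> _; rewrite big_nil.
rewrite mulnS => sz_v uv; have Dv : v = u ++ drop (size u) v.
  have := congr1 (take (size u)) uv; rewrite take_size_cat // takel_cat => [Du|].
    by rewrite -{1}(cat_take_drop (size u) v) -Du.
  by rewrite sz_v leq_addr.
set w := drop _ v in Dv; have sz_w : size w = (size u * e)%N.
  by apply: (@addnI (size u)); rewrite -size_cat -Dv.
rewrite Dv big_cat expgS /= (IH w) //.
by apply/eqP; move/eqP: uv; rewrite Dv -catA eqseq_cat // eqxx.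
Qed.

Section Vanishing.

Variables (gT : finGroupType) (G : {group gT}) (i : Iirr G) (p : nat).
Local Notation chi := 'chi_i.

(** Let [n = |G| / chi 1], which is prime to [p], let [p ^ a] be the [p]-part of
    [|G|] and let [C] be the class of [g]. Then [n ^ k * |C| * chi g] is the sum
    of [chi t_0 * ... * chi t_k] over the tuples [t] in [G] with product in [C].
    Take [k + 1 = p ^ (a + b)]. Rotations permute these tuples. A tuple that is
    fixed by the rotation by [p ^ b] steps has a product of the form
    [h ^ (p ^ a)], whose order is prime to [p], so that it is not conjugate to
    [g]. By [sum_perm_dvdA] the sum is divisible by [p ^ b.+1]. Thus every power
    of [p] divides the algebraic integer [|C| * chi g], which must be 0. *)
Lemma irr_vanish_defect0 (g : gT) :
    prime p -> ~~ (p %| #|G|%:R / chi 1%g)%C -> g \in G -> (p %| #[g]%g)%N ->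
  chi g = 0.
Proof.
move=> pr_p; have /dvdCP_nat := dvd_irr1_cardG i.
rewrite ler0n char1_ge0 ?irr_char // => /(_ isT isT)[n].
rewrite -[X in X = _ -> _]/(#|G|%:R) => Dn.
have nz1 := irr1_neq0 i; rewrite {1}Dn mulfK // dvdC_nat => p'n Gg p_g.
pose C := g ^: G; pose a := logn p #|G|.
suffices: #|C|%:R * chi g = 0.
  move/eqP; rewrite mulf_eq0 pnatr_eq0 cards_eq0 => /orP[/eqP C0 | /eqP//].
  by have := class_refl G g; rewrite -/C C0 inE.
apply: (Aint_dvd_expn_eq0 (prime_gt1 pr_p)) => b.
pose k := (p ^ (a + b)).-1; have Dk : k.+1 = (p ^ (a + b))%N.
  by rewrite prednK // expn_gt0 prime_gt0.
pose shift (t : k.+1.-tuple gT) := [tuple of seq.rot 1 t].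
have shift_inj : injective shift.
  by move=> t u /(congr1 val) /= /rot_inj/val_inj.
pose s := perm shift_inj.
have valsX (t : k.+1.-tuple gT) (j : nat) : (j <= k.+1)%N -> val ((s ^+ j)%g t) = seq.rot j t.
  elim: j => [|j IH] lt_j; first by rewrite expg0 perm1 seq.rot0.
  by rewrite expgSr permM permE rotS ?size_tuple // [val _]/= (IH (ltnW lt_j)).
pose A := [set t : k.+1.-tuple gT | all (mem G) t & (\prod_(x <- t) x)%g \in C].
pose F (t : k.+1.-tuple gT) := \prod_(x <- t) chi x.
have sumA : \sum_(t in A) F t = n%:R ^+ k * (#|C|%:R * chi g).
  transitivity (\sum_(c in C) n%:R ^+ k * chi c); last first.
    rewrite -mulr_sumr; congr (_ * _); rewrite mulr_natl -sumr_const.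
    by apply: eq_bigr => _ /imsetP[x Gx ->]; rewrite cfunJ.
  have -> : n%:R = #|G|%:R / chi 1%g by rewrite Dn mulfK.
  under [RHS]eq_bigr => c _ do rewrite -irr_convolution_tuple.
  rewrite (eq_bigl (fun t : k.+1.-tuple gT => all (mem G) t && ((\prod_(x <- t) x)%g \in C))) => [|t]; last by rewrite inE.
  rewrite big_mkcondl (partition_big (fun t : k.+1.-tuple gT => (\prod_(x <- t) x)%g) (mem C)) //=.
  apply: eq_bigr => c Cc; apply: eq_big => [t | t _].
    by apply: andb_idl => /eqP->.
  case: ifP => // /negbT; rewrite -has_predC => /hasP[x tx /= nGx].
  by rewrite /F (big_rem x) //= cfun0 ?mul0r.
have divA : (\sum_(t in A) F t) / p%:R ^+ b.+1 \in Aint.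
  apply: (@sum_perm_dvdA _ s A p (a + b)) => //.
  - by apply/permP=> t; apply: val_inj; rewrite -Dk valsX // perm1 -{1}(size_tuple t) rot_size.
  - move=> t; rewrite permE !inE /= (eq_all_r (mem_rot 1 t)); apply: andb_id2l => /allP Gt.
    case/tupleP: t Gt => x t Gt; rewrite rot1_cons big_rcons big_cons /=.
    have Gx : x \in G by apply: Gt; rewrite mem_head.
    set P := (\prod_(_ <- _) _)%g; have -> : (P * x = (x * P) ^ x)%g.
      by rewrite /conjg -!mulgA mulKg.
    by rewrite memJ_norm // (subsetP (class_norm g G)).
  - by move=> t; rewrite permE /F; apply: perm_big; rewrite perm_rot.
  - by move=> t; rewrite /F rpred_prod // => x _; apply: Aint_irr.
  move=> t; rewrite inE => /andP[/allP Gt Ct]; apply: contraL Ct => /eqP fix_t.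
  have le_bk : (p ^ b <= k.+1)%N by rewrite Dk leq_pexp2l ?prime_gt0 ?leq_addl.
  have := valsX t _ le_bk; rewrite fix_t => rot_t.
  pose u := take (p ^ b) t; have Dt : t = u ++ drop (p ^ b) t :> seq gT.
    by rewrite cat_take_drop.
  have -> : (\prod_(x <- t) x = (\prod_(x <- u) x) ^+ (p ^ a))%g.
    apply: prod_commuting_word.
      by rewrite size_takel size_tuple // Dk -expnD addnC.
    by rewrite {1}rot_t /seq.rot catA -Dt.
  set h := (\prod_(_ <- _) _)%g; apply/negP=> /imsetP[z Gz Dh].
  have Gh : h \in G by rewrite /h big_seq group_prod // => x /mem_take/Gt.
  have: (p %| #|G|`_p^')%N.
    apply: dvdn_trans p_g _; rewrite -(orderJ g z) -Dh order_dvdn -expgM.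
    by rewrite -p_part partnC ?cardG_gt0 // expg_cardG.
  by apply/negP; rewrite -p'natE // part_pnat.
have coNp : coprime (n ^ k) (p ^ b).
  by rewrite coprimeXl // coprimeXr // coprime_sym prime_coprime.
have nk_gt0 : (0 < n ^ k)%N.
  by rewrite expn_gt0; case: (n) p'n; rewrite ?dvdn0.
have [u v Duv _] := egcdnP (p ^ b) nk_gt0.
rewrite (eqP coNp) in Duv; have := congr1 (fun m => m%:R : algC) Duv.
set z := _ * chi g in sumA *; rewrite natrD !natrM !natrX => Dz.
have nz_p : p%:R != 0 :> algC by rewrite pnatr_eq0 -lt0n prime_gt0.
have -> : z / p%:R ^+ b = u%:R * p%:R * ((\sum_(t in A) F t) / p%:R ^+ b.+1) - v%:R * z.
  have nz_pb := expf_neq0 b nz_p; rewrite sumA exprS.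
  move: (p%:R ^+ b) nz_pb Dz => pb nz_pb Dz.
  have {1}-> : z = (u%:R * n%:R ^+ k - v%:R * pb) * z.
    by rewrite Dz addrAC subrr add0r mul1r.
  have calc (N U V w P Q : algC) : P != 0 -> Q != 0 ->
      (U * N - V * Q) * w / Q = U * P * (N * w / (P * Q)) - V * w.
    by move=> nzP nzQ; field; apply/andP.
  exact: calc.
rewrite rpredB //; first by rewrite rpredM ?divA // rpredM ?rpred_nat.
by rewrite !rpredM ?rpred_nat ?Aint_irr.
Qed.

End Vanishing.

(** * Codegrees and commuting elements of prime order *)

Section ElementOrders.

Variables (gT : finGroupType) (G : {group gT}).
Implicit Types (i : Iirr G) (p q : nat) (x y : gT).

Lemma dvd_codegree_index i (d : nat) : (d %| codegree 'chi_i)%C ->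
  (d %| #|G : cfker 'chi_i|)%N.
Proof.
have /natrP[n Dn] := codegree_nat i; have /natrP[m Dm] := Cnat_irr1 i.
have -> : #|G : cfker 'chi_i| = (n * m)%N.
  apply/eqP; rewrite -eqC_nat natrM -Dn -Dm /codegree.
  by rewrite divfK ?irr1_neq0.
by rewrite Dn dvdC_nat => /dvdn_mulr->.
Qed.

Lemma dvdC_codegree_mul i p q : prime p -> prime q -> p != q ->
  ((p * q)%N %| codegree 'chi_i)%C =
    (p %| codegree 'chi_i)%C && (q %| codegree 'chi_i)%C.
Proof.
move=> pr_p pr_q neq_pq; have /natrP[n ->] := codegree_nat i.
by rewrite !dvdC_nat Gauss_dvd // prime_coprime // dvdn_prime2.
Qed.

(** In the quotient by the kernel of the character, [x] still has order [p], and
    the codegree is the quotient of the group order by the degree. *)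
Lemma irr_vanish_codegree i p x y :
    prime p -> x \in G -> y \in G -> commute x y -> #[x]%g = p ->
    coprime p #[y]%g -> ~~ (p %| codegree 'chi_i)%C -> x \notin cfker 'chi_i ->
  'chi_i (x * y)%g = 0.
Proof.
move=> pr_p Gx Gy cxy ox co_py p'cod notKx; set K := cfker _ in notKx.
have nsKG : K <| G := cfker_normal _; have nKG := normal_norm nsKG.
have [nKx nKy] := (subsetP nKG x Gx, subsetP nKG y Gy).
rewrite -[i](quo_IirrK nsKG) // mod_IirrE // cfModE ?groupM //.
have ocx : #[coset K x]%g = p.
  have := morph_order (coset_morphism K) nKx; rewrite ox => /(prime_nt_dvdP pr_p) <- //.
  by rewrite order_eq1; apply: contra notKx => /eqP/coset_idr->.
apply: (irr_vanish_defect0 pr_p); last 1 first.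
- rewrite morphM // orderM ?ocx ?dvdn_mulr //.
    by red; rewrite -!morphM // cxy.
  by apply: coprime_dvdr co_py; apply: morph_order.
- by rewrite quo_IirrE // cfQuo1 // card_quotient.
by rewrite mem_quotient ?groupM.
Qed.

(** This is the value of the regular character of [G / N] at the image of [y],
    which is not 1. *)
Lemma sum_irr_quo_reg (N : {group gT}) y : N <| G -> y \in G -> y \notin N ->
  \sum_(i | N \subset cfker 'chi[G]_i) 'chi_i y * ('chi_i 1%g)^* = 0.
Proof.
move=> nsNG Gy notNy; have nNy := subsetP (normal_norm nsNG) y Gy.
rewrite (reindex _ (mod_Iirr_bij nsNG)) /=.
transitivity (\sum_j 'chi[G / N]_j (coset N y) * ('chi_j (coset N 1%g))^*).
  by apply: eq_big => [j | j _]; rewrite mod_IirrE ?cfker_mod ?cfModE.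
rewrite second_orthogonality_relation ?mem_quotient // morph1 class1G inE.
case: eqP => [/(coset_idr nNy) Ny | //]; by rewrite Ny in notNy.
Qed.

(** Otherwise every irreducible character vanishes at [x] or has [x] in its
    kernel, and the regular character would be positive at [x]. *)
Lemma codegree_prime_order p x : prime p -> x \in G -> #[x]%g = p ->
  exists i, (p %| codegree 'chi[G]_i)%C.
Proof.
move=> pr_p Gx ox; apply/existsP; apply: contraT => /existsPn no_p.
have : \sum_i 'chi[G]_i x * ('chi_i 1%g)^* = 0.
  rewrite second_orthogonality_relation // class1G inE -order_eq1 ox.
  by rewrite eqn_leq leqNgt prime_gt1.
rewrite (bigD1 0) //= irr0 !cfun1E Gx group1 conjC1 mulr1 => /eqP.
rewrite gt_eqF // ltr_pwDl ?ltr0n //; apply: sumr_ge0 => i _.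
have [kerx | nkerx] := boolP (x \in cfker 'chi_i).
  by rewrite (cfker1 kerx) mul_conjC_ge0.
by rewrite -[x]mulg1 (irr_vanish_codegree pr_p) ?mul0r ?order1 ?coprimen1 //; apply: commute1.
Qed.

Let ker_closure i x : (<<x ^: G>> \subset cfker 'chi[G]_i)%g = (x \in cfker 'chi_i).
Proof.
have /andP[_ nKG] := cfker_normal 'chi[G]_i.
rewrite gen_subG; apply/idP/idP=> [/subsetP-> // | Kx]; first exact: class_refl.
by apply/subsetP=> _ /imsetP[z Gz ->]; rewrite memJ_norm ?(subsetP nKG).
Qed.

Let normal_closure x : x \in G -> (<<x ^: G>> <| G)%g.
Proof.
move=> Gx; rewrite /normal gen_subG class_subG //=.
exact: subset_trans (class_norm x G) (norms_gen _).
Qed.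

Let sum_irr_gt0 (P : pred (Iirr G)) x : x \in G -> P 0 ->
  0 < \sum_(i | P i) 'chi[G]_i x * ('chi_i x)^*.
Proof.
move=> Gx P0; rewrite (bigD1 0) //= irr0 !cfun1E Gx conjC1 mulr1.
by rewrite ltr_pwDl ?ltr0n // sumr_ge0 // => i _; rewrite mul_conjC_ge0.
Qed.

Let sum_irr_orth x y : y \in G -> #[x]%g != #[y]%g ->
  \sum_i 'chi[G]_i x * ('chi_i y)^* = 0.
Proof.
move=> Gy ox; rewrite second_orthogonality_relation // [_ \in _]negbTE //.
by apply: contra ox => /imsetP[z _ ->]; rewrite orderJ.
Qed.

(** Every kernel that contains [x] contains [y]. If [chi] vanished at [x * y]
    whenever its kernel contains neither, the terms of the orthogonality
    relation between [x * y] and [x] would be 0 or [|chi x| ^ 2], the trivial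
    character contributing 1. *)
Let closure_nonvanish x y :
    x \in G -> y \in <<x ^: G>>%g -> #[x * y]%g != #[x]%g ->
  exists i, [&& x \notin cfker 'chi[G]_i, y \notin cfker 'chi_i & 'chi_i (x * y)%g != 0].
Proof.
move=> Gx Xy oxy; apply/existsP; apply: contraT => /existsPn vanish.
have Gy: y \in G by apply: subsetP Xy; rewrite gen_subG class_subG.
have := @sum_irr_gt0 (fun i => y \in cfker 'chi_i) x Gx.
rewrite cfker_irr0 => /(_ Gy); rewrite lt_neqAle eq_sym => /andP[/eqP[]].
apply: etrans (sum_irr_orth Gx oxy); rewrite big_mkcond; apply: eq_bigr => i _.
case: ifP => [Ky | /negbT nKy]; first by rewrite cfkerMr.
have := vanish i; rewrite nKy /= negb_and !negbK => /orP[Kx | /eqP->].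
  by rewrite -ker_closure in Kx; rewrite (subsetP Kx _ Xy) in nKy.
by rewrite mul0r.
Qed.

(** Otherwise [chi (x * y) = 0] for every [chi] whose kernel contains neither
    [x] nor [y], by [irr_vanish_codegree]. If [y] is in the normal closure of
    [x], or [x] in that of [y], this contradicts [closure_nonvanish]. If not,
    the regular characters of [G] and of its quotients by the normal closures
    of [x] and of [y] vanish at [x * y], [y] and [x], respectively. Comparing
    these three sums, one finds that the sum of [chi 1 ^ 2] over the [chi]
    whose kernel contains [x] and [y] is 0, though the trivial character occurs
    in it. *)
Lemma codegree_prime_orders p q x y :
    prime p -> prime q -> p != q -> x \in G -> y \in G -> commute x y ->
    #[x]%g = p -> #[y]%g = q ->
  exists i, ((p * q)%N %| codegree 'chi[G]_i)%C.
Proof.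
move=> pr_p pr_q neq_pq Gx Gy cxy ox oy.
apply/existsP; apply: contraT => /existsPn no_pq.
have co_pq : coprime p q by rewrite prime_coprime // dvdn_prime2.
have vanish i : x \notin cfker 'chi_i -> y \notin cfker 'chi_i -> 'chi_i (x * y)%g = 0.
  move=> nkx nky; have := no_pq i; rewrite dvdC_codegree_mul // negb_and.
  case/orP=> [p'cod | q'cod]; first by rewrite (irr_vanish_codegree pr_p) ?oy.
  by rewrite cxy (irr_vanish_codegree pr_q) ?ox // coprime_sym.
have oxy : #[x * y]%g = (p * q)%N by rewrite orderM // ?ox ?oy.
have [p_gt0 q_gt0] := (prime_gt0 pr_p, prime_gt0 pr_q).
have [p_gt1 q_gt1] := (prime_gt1 pr_p, prime_gt1 pr_q).
have [Xy | notXy] := boolP (y \in <<x ^: G>>%g).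
  have [|i /and3P[nKx nKy /eqP[]]] := closure_nonvanish Gx Xy; last exact: vanish.
  by rewrite oxy ox neq_ltn ltn_Pmulr ?orbT.
have [Yx | notYx] := boolP (x \in <<y ^: G>>%g).
  have [|i /and3P[nKy nKx /eqP[]]] := closure_nonvanish Gy Yx.
    by rewrite -cxy oxy oy neq_ltn ltn_Pmull ?orbT.
  by rewrite -cxy vanish.
have := @sum_irr_gt0 (fun i => (x \in cfker 'chi_i) && (y \in cfker 'chi_i)) 1%g (group1 G).
rewrite cfker_irr0 Gx Gy => /(_ isT); rewrite lt_neqAle eq_sym => /andP[/eqP[]].
have : #[x * y]%g != #[1%g : gT]%g.
  by rewrite oxy order1 muln_eq1 negb_and !neq_ltn p_gt1 orbT.
move=> /(sum_irr_orth (group1 G)).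
have := sum_irr_quo_reg (normal_closure Gx) Gy notXy.
have := sum_irr_quo_reg (normal_closure Gy) Gx notYx.
move=> sumY sumX sumXY.
apply: (addIr (\sum_i 'chi[G]_i (x * y)%g * ('chi_i 1%g)^*)).
apply: etrans (_ : _ = \sum_(i | <<x ^: G>>%g \subset cfker 'chi[G]_i) 'chi_i y * ('chi_i 1%g)^*
  + \sum_(i | <<y ^: G>>%g \subset cfker 'chi[G]_i) 'chi_i x * ('chi_i 1%g)^*) _; last first.
  by rewrite sumX sumY sumXY.
rewrite big_mkcond [X in _ = X + _]big_mkcond [X in _ = _ + X]big_mkcond -!big_split.
apply: eq_bigr => i _; rewrite /= !ker_closure.
case: ifP => [/andP[Kx Ky] | ].
  by rewrite Kx Ky cfkerMl // (cfker1 Kx) (cfker1 Ky).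
case: ifP => [Kx /= -> | /negbT nKx _].
  by rewrite cfkerMl // add0r addr0.
case: ifP => [Ky | /negbT nKy]; first by rewrite cfkerMr ?add0r ?addr0.
by rewrite vanish // mul0r.
Qed.

End ElementOrders.

(** * Fixed-point-free families of automorphisms *)

Section FixedPointFreeSum.

Import FiniteModule.
Local Open Scope group_scope.

Variables (gT : finGroupType) (M : {group gT}).
Hypothesis abM : abelian M.
Local Notation fmod := (fmod abM).
Local Notation fmod_of := (fmod_of abM).

Let fixed0 (w : fmod_of) (A : {set gT}) : A \subset 'N(M) -> 'C_M(A) = 1 ->
  (forall x, x \in A -> (w ^@ x)%R = w) -> w = 0%R.
Proof.
move=> nMA C1 fix_w; apply: val_inj; rewrite fmval0; apply/set1gP; rewrite -C1.
rewrite inE fmodP; apply/centP=> x Ax; apply/commgP/conjg_fixP.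
by rewrite -fmvalJ ?(subsetP nMA) // fix_w.
Qed.

(** For [v] in [M], the sum of the images of [v] under a coset of [K] is fixed
    by a conjugate of [K], hence trivial; the sum of its images under the powers
    of [f x] is fixed by [f x], hence trivial. Add up the latter over the [x] in
    [K]: the terms with exponent 0 give [#|K|] times [v], and those with an
    exponent [j > 0] run over the coset [K :* y ^+ j]. This is how one shows
    that an elementary abelian group of rank 2, or a Frobenius group with kernel
    [K] and complement [<[y]>], does not act freely on a nontrivial abelian
    group of coprime order. *)
Lemma fpf_sum_expg (K : {group gT}) (f : gT -> gT) (r : nat) (y : gT) :
    (0 < r)%N -> K \subset 'N(M) -> y \in 'N(M) -> 'C_M(K) = 1 ->
    {in K, forall x, [/\ f x \in 'N(M), f x ^+ r = 1 & 'C_M[f x] = 1]} ->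
    (forall j, (0 < j < r)%N -> {in K &, injective (fun x => f x ^+ j)}) ->
    (forall j x, (0 < j < r)%N -> x \in K -> f x ^+ j \in K :* (y ^+ j)) ->
  {in M, forall v, v ^+ #|K| = 1}.
Proof.
move=> r_gt0 nMK nMy CK1 fP f_inj f_coset v Mv.
pose u := fmod v.
suffices: (u *+ #|K|)%R = 0%R.
  by rewrite -(fmodX _ _ Mv) => /(congr1 val); rewrite fmodK ?groupX.
have sumK : (\sum_(x in K) u ^@ x)%R = 0%R.
  apply: (fixed0 nMK CK1) => z Kz; rewrite actr_sum [RHS](reindex_inj (mulIg z)) /=.
  apply: eq_big => [x | x Kx]; first by rewrite groupMr.
  by rewrite actrM // (subsetP nMK).
have sum_f x : x \in K -> (\sum_(j < r) u ^@ (f x ^+ j))%R = 0%R.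
  move=> Kx; have [nMf fr1 C1] := fP x Kx.
  apply: (@fixed0 _ [set f x]); rewrite ?sub1set ?cent_set1 // => _ /set1P->.
  case: r r_gt0 fr1 {f_inj f_coset fP} => // r' _ fr1.
  rewrite actr_sum big_ord_recr big_ord_recl /= addrC; congr (_ + _)%R.
    by rewrite -actrM ?groupX // -expgSr fr1 expg0.
  by apply: eq_bigr => j _; rewrite -actrM ?groupX // -expgSr.
have: (\sum_(x in K) \sum_(j < r) u ^@ (f x ^+ j))%R = 0%R by rewrite big1.
rewrite exchange_big; case: r r_gt0 f_inj f_coset {fP sum_f} => // r' _ f_inj f_coset.
rewrite big_ord_recl /= [X in (_ + X)%R]big1 ?addr0 => [|j _].
  by under eq_bigr do rewrite expg0 actr1; rewrite sumr_const.
have lt_j : (0 < bump 0 j < r'.+1)%N by rewrite ltnS ltn_ord.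
rewrite -(big_imset (fun h => u ^@ h)%R) /=; last exact: f_inj.
have -> : [set f x ^+ bump 0 j | x in K] = K :* (y ^+ bump 0 j).
  apply/eqP; rewrite eqEcard card_rcoset card_in_imset ?leqnn ?andbT; last exact: f_inj.
  by apply/subsetP=> _ /imsetP[x Kx ->]; apply: f_coset.
rewrite -rcosetE /rcoset big_imset /=; last by apply: in2W; apply: mulIg.
under eq_bigr => x Kx do rewrite actrM ?groupX // ?(subsetP nMK) //.
by rewrite -actr_sum sumK act0r.
Qed.

End FixedPointFreeSum.

(** * Groups without elements of order p q *)

Section NoCommutingElements.

Local Open Scope group_scope.

(** Nonadjacency in the Gruenberg-Kegel graph of [G]: for distinct primes, no
    element of order [p * q]. Stated with divisibility, it visibly passes to
    quotients. *)
Definition gk_nonadjacent (gT : finGroupType) (G : {set gT}) (p q : nat) : bool :=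
  [forall z in G, ~~ (p * q %| #[z])%N].

Lemma gk_nonadjacent_sym (gT : finGroupType) (G : {set gT}) p q :
  gk_nonadjacent G p q = gk_nonadjacent G q p.
Proof. by rewrite /gk_nonadjacent mulnC. Qed.

Lemma gk_nonadjacentS (gT : finGroupType) (G H : {set gT}) p q :
  H \subset G -> gk_nonadjacent G p q -> gk_nonadjacent H p q.
Proof.
by move=> sHG /forall_inP nc; apply/forall_inP=> z /(subsetP sHG)/nc.
Qed.

Lemma gk_nonadjacent_quotient (gT : finGroupType) (G : {set gT}) (N : {group gT}) p q :
  gk_nonadjacent G p q -> gk_nonadjacent (G / N) p q.
Proof.
move=> /forall_inP nc; apply/forall_inP=> _ /morphimP[z nNz Gz ->].
by apply: contra (nc z Gz) => /dvdn_trans->//; apply: morph_order.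
Qed.

Lemma p_elt_pdiv (gT : finGroupType) (p : nat) (x : gT) :
  p.-elt x -> x != 1 -> prime p /\ (p %| #[x])%N.
Proof. by rewrite -cycle_eq1 => px /(pgroup_pdiv px)[]. Qed.

Lemma gk_nonadjacent_commute (gT : finGroupType) (G : {group gT}) p q x y :
    gk_nonadjacent G p q -> p != q -> x \in G -> y \in G ->
    p.-elt x -> q.-elt y -> commute x y -> y != 1 -> x = 1.
Proof.
move=> /forall_inP nc neq_pq Gx Gy px qy cxy nty; apply/eqP/negPn/negP=> ntx.
have co_xy : coprime #[x] #[y].
  by apply: pnat_coprime px _; apply: sub_in_pnat qy => r _ /eqnP->; rewrite !inE eq_sym.
have [[_ ox] [_ oy]] := (p_elt_pdiv px ntx, p_elt_pdiv qy nty).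
by case/negP: (nc _ (groupM Gx Gy)); rewrite orderM // dvdn_mul.
Qed.

Lemma gk_nonadjacent_cent1 (gT : finGroupType) (G Q : {group gT}) p q x :
    gk_nonadjacent G p q -> p != q -> x \in G -> p.-elt x -> x != 1 ->
    Q \subset G -> q.-group Q -> 'C_Q[x] = 1.
Proof.
move=> nc neq_pq Gx px ntx sQG qQ; apply/trivgP/subsetP=> y /setIP[Qy /cent1P cxy].
apply/set1P; apply: (@gk_nonadjacent_commute _ G q p y x) => //.
- by rewrite gk_nonadjacent_sym.
- by rewrite eq_sym.
- exact: (subsetP sQG).
- exact: mem_p_elt Qy.
Qed.

(** The map [z |-> [~ z, x]] from [Q] to [Q] is injective. *)
Lemma commg_regular (gT : finGroupType) (Q : {group gT}) x :
  x \in 'N(Q) -> 'C_Q[x] = 1 -> [~: Q, <[x]>] = Q.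
Proof.
move=> nQx C1; apply/eqP; rewrite eqEsubset commg_subl cycle_subG nQx /=.
have inj : {in Q &, injective (fun z => [~ z, x])}.
  move=> z w Qz Qw /= eq_zw; apply/eqP; rewrite eq_mulgV1 -in_set1.
  rewrite -[[set 1]]C1 inE groupM ?groupV //=; apply/cent1P/commgP/conjg_fixP.
  by rewrite conjMg conjVg !conjg_mulR eq_zw invMg mulgA mulgK.
have defQ : [set [~ z, x] | z in Q] = Q.
  apply/eqP; rewrite eqEcard card_in_imset // leqnn andbT.
  apply/subsetP=> _ /imsetP[z Qz ->].
  by rewrite commgEl groupM ?groupV // memJ_norm.
rewrite -{1}defQ; apply/subsetP=> _ /imsetP[z Qz ->].
by rewrite mem_commg ?cycle_id.
Qed.

Lemma gk_nonadjacent_commg (gT : finGroupType) (G Q : {group gT}) p q x :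
    gk_nonadjacent G p q -> p != q -> x \in G -> p.-elt x -> x != 1 ->
    Q \subset G -> q.-group Q -> x \in 'N(Q) -> [~: Q, <[x]>] = Q.
Proof.
move=> nc neq_pq Gx px ntx sQG qQ nQx.
by rewrite commg_regular //; apply: (gk_nonadjacent_cent1 nc neq_pq Gx).
Qed.

(** If [T] contained [<[x]>] of order [t] and [y] outside it, the elements
    [z * y] with [z] in [<[x]>] would satisfy the conditions of [fpf_sum_expg]
    on the centre of [F], whose order is prime to [t]. *)
Lemma regular_abelem_prime (gT : finGroupType) (G F T : {group gT}) s t :
    gk_nonadjacent G s t -> s != t -> F \subset G -> T \subset G ->
    s.-group F -> F :!=: 1 -> T \subset 'N(F) -> t.-abelem T -> T :!=: 1 ->
  prime t /\ #|T| = t.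
Proof.
move=> nc neq_st sFG sTG sF ntF nFT abT ntT.
have [tT abelT _] := and3P abT; have [pr_t t_T _] := pgroup_pdiv tT ntT.
split=> //; have [x Tx ox] := Cauchy pr_t t_T.
have ntx : x != 1 by rewrite -order_gt1 ox prime_gt1.
have [sTx | /subsetPn[y Ty notxy]] := boolP (T \subset <[x]>).
  by rewrite -ox; congr #|pred_of_set _|; apply/eqP; rewrite eqEsubset sTx cycle_subG Tx.
pose M := 'Z(F)%G; have abM : abelian M := center_abelian F.
have sMG : M \subset G by rewrite gFsub_trans.
have sM : s.-group M by rewrite (pgroupS (center_sub F)).
have ntM : M :!=: 1 by rewrite (center_nil_eq1 (pgroup_nil sF)).
have nMT : T \subset 'N(M) by rewrite gFnorm_trans.
have C1 z : z \in T -> z != 1 -> 'C_M[z] = 1.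
  move=> Tz ntz; rewrite gk_nonadjacent_sym eq_sym in nc neq_st.
  apply: (gk_nonadjacent_cent1 nc) => //; first exact: (subsetP sTG).
  exact: mem_p_elt Tz.
have [v Mv ntv] := trivgPn _ ntM.
have expt z : z \in T -> z ^+ t = 1.
  by case/(abelemP pr_t): abT => _; apply.
have sxT : <[x]> \subset T by rewrite cycle_subG.
have cTT := centsP abelT.
have [y_T Mv_s] : y \in 'N(M) /\ s.-elt v by split; [apply: (subsetP nMT) | apply: mem_p_elt Mv].
have eq_t1 : (v ^+ #|<[x]>|)%g = 1.
  apply: (fpf_sum_expg abM (f := fun z => z * y) (r := t) (y := y)) => //.
  - exact: prime_gt0.
  - exact: subset_trans nMT.
  - by rewrite cent_cycle C1.
  - move=> z xz; have Tz := subsetP sxT z xz.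
    have ntzy : z * y != 1.
      by rewrite -eq_invg_mul; apply: contraNneq notxy => <-; rewrite groupV.
    by rewrite (subsetP nMT) ?expt ?C1 ?groupM.
  - move=> j /andP[j_gt0 lt_jt] z w xz xw /=.
    have [Tz Tw] := (subsetP sxT z xz, subsetP sxT w xw).
    rewrite !expgMn; try exact: cTT; move/mulIg=> eq_zw.
    apply/eqP; rewrite eq_mulgV1 -order_eq1 -dvdn1.
    have /eqP <- : coprime t j by rewrite prime_coprime // gtnNdvd.
    rewrite dvdn_gcd !order_dvdn expt ?groupM ?groupV // eqxx /=.
    by rewrite expgMn ?expgVn ?eq_zw ?mulgV //; apply: cTT; rewrite ?groupV.
  move=> j z _ xz; rewrite expgMn; last by apply: cTT => //; apply: (subsetP sxT).
  by rewrite mem_rcoset mulgK groupX.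
case/eqP: ntv; apply/eqP; rewrite -order_eq1 -dvdn1.
have /eqP <- : coprime #[v] #|<[x]>|.
  apply: pnat_coprime Mv_s _; rewrite -orderE ox pnatE // !inE eq_sym //.
by rewrite dvdn_gcd dvdnn /= order_dvdn eq_t1.
Qed.

End NoCommutingElements.

(** * Orienting the pairs of nonadjacent primes *)

Section SolvableOrders.

Local Open Scope group_scope.

Implicit Types gT : finGroupType.

(** As [t] does not divide [#|N|], the group [E] is isomorphic to a Sylow
    subgroup of its preimage, to which [regular_abelem_prime] applies. *)
Lemma quotient_abelem_prime gT (G N F : {group gT}) (E : {group coset_of N}) s t :
    gk_nonadjacent G s t -> s != t -> N <| G -> ~~ (t %| #|N|)%N ->
    F <| G -> s.-group F -> F :!=: 1 ->
    E \subset G / N -> t.-abelem E -> E :!=: 1 ->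
  prime t /\ #|E| = t.
Proof.
move=> nc neq_st nsNG t'N nsFG sF ntF sEG abE ntE.
have [pr_t t_E _] := pgroup_pdiv (abelem_pgroup abE) ntE; split=> //.
have [E0 defE sNE0 sE0G] := inv_quotientS nsNG sEG.
have [T sylT] := Sylow_exists t E0; have sTE0 := pHall_sub sylT.
have nNT : T \subset 'N(N) by rewrite (subset_trans sTE0) ?(subset_trans sE0G) ?normal_norm.
have defTE : T / N = E.
  have := quotient_pHall nNT sylT; rewrite -defE => /pHall_id; apply.
  exact: abelem_pgroup abE.
have tiNT : N :&: T = 1.
  apply: coprime_TIg; rewrite coprime_sym; apply: pnat_coprime (pHall_pgroup sylT) _.
  by rewrite p'natE.
have isoT := quotient_isog nNT tiNT; rewrite defTE in isoT.
rewrite -(card_isog isoT); have sTG := subset_trans sTE0 sE0G.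
have [|||_ ->] := regular_abelem_prime nc neq_st (normal_sub nsFG) sTG sF ntF _ _ _; rewrite //.
- exact: subset_trans sTG (normal_norm nsFG).
- by rewrite (isog_abelem isoT).
by rewrite -(isog_eq1 isoT) in ntE.
Qed.

(** The quotient [G / 'C_G(E)] embeds in the cyclic group [Aut E], of order
    [q - 1]. *)
Lemma prime_normal_cent gT (G E : {group gT}) q : E <| G -> prime q -> #|E| = q ->
  (#|G : 'C_G(E)| %| q.-1)%N /\ G^`(1) \subset 'C(E).
Proof.
move=> /andP[sEG nEG] pr_q oE; have cycE : cyclic E by rewrite prime_cyclic ?oE.
have sAut := Aut_conj_aut E G; split.
  have := cardSg sAut; rewrite card_morphim ker_conj_aut (setIidPr nEG).
  by rewrite card_Aut_cyclic // oE totient_prime // -indexgI.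
have := abelianS sAut (Aut_cyclic_abelian cycE).
rewrite -[abelian _]/(_ \subset _) => /commG1P; rewrite -morphimR // => R1.
rewrite -(ker_conj_aut E) /ker -sub_morphim_pre ?R1 //.
by rewrite comm_subG.
Qed.

Lemma solvable_minnormal gT (G : {group gT}) : solvable G -> G :!=: 1 ->
  exists (p : nat) (M : {group gT}), [/\ prime p, M <| G, p.-abelem M & M :!=: 1].
Proof.
move=> solG ntG; have [M minM sMG] := minnormal_exists ntG (normG G).
have [nMG ntM /is_abelemP[p pr_p abM]] := minnormal_solvable minM sMG solG.
by exists p, M; rewrite /normal sMG.
Qed.

(** The arrow from [p] to [q] by which the pairs of nonadjacent primes are
    oriented. *)
Definition normalizes_Sylow gT (G : {set gT}) (p q : nat) : bool :=
  [exists Q : {group gT}, q.-Sylow(G) Q && (p %| #|'N_G(Q)|)%N].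

(** Put [F = 'O_p(H)]. A minimal normal subgroup [E] of [H / F] is a [q]-group,
    of order [q] by [quotient_abelem_prime]. Its centraliser is a [q]-group,
    since no element has order [p * q], and its index divides [q - 1]; so it is
    a normal Sylow [q]-subgroup of [H / F]. For a Sylow [q]-subgroup [Q] of [H]
    it follows that [F * Q] is normal and that [H = F * 'N_H(Q)]. If [p] does
    not divide [#|'N_H(Q)|], then [F] is a normal Sylow [p]-subgroup. *)
Lemma normalizes_Sylow_pcore gT (H : {group gT}) p q :
    solvable H -> prime p -> prime q -> p != q -> gk_nonadjacent H p q ->
    (forall r, prime r -> r %| #|H| -> (r == p) || (r == q))%N ->
    (q %| #|H|)%N -> 'O_p(H) != 1 ->
  normalizes_Sylow H p q || normalizes_Sylow H q p.
Proof.
move=> solH pr_p pr_q neq_pq nc pqH q_H ntF; set F := 'O_p(H)%G in ntF.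
have nsFH : F <| H := pcore_normal p H; have pF : p.-group F := pcore_pgroup p H.
have nFH := normal_norm nsFH.
have q'F : ~~ (q %| #|F|)%N.
  by rewrite -p'natE //; apply: sub_in_pnat pF => r _ /eqnP->; rewrite !inE.
have q_Hb : (q %| #|H / F|)%N.
  move: q_H; rewrite -(Lagrange (normal_sub nsFH)) Euclid_dvdM // (negPf q'F).
  by rewrite card_quotient.
have pqHb r : prime r -> (r %| #|H / F|)%N -> (r == p) || (r == q).
  by move=> pr_r /dvdn_trans/(_ (dvdn_quotient _ _)); apply: pqH.
have ntHb : H / F != 1.
  by apply: contraTneq q_Hb => ->; rewrite cards1 dvdn1 neq_ltn prime_gt1 ?orbT.
have [r [E [pr_r nsEH abE ntE]]] := solvable_minnormal (quotient_sol F solH) ntHb.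
have r_E : (r %| #|E|)%N by have [_ ] := pgroup_pdiv (abelem_pgroup abE) ntE.
have {r pr_r abE r_E} abE : q.-abelem E.
  have /orP[/eqP Dr | /eqP<- //] := pqHb r pr_r (dvdn_trans r_E (cardSg (normal_sub nsEH))).
  case/negP: ntE; rewrite -subG1 -(trivg_pcore_quotient p H) pcore_max //.
  by rewrite -Dr (abelem_pgroup abE).
have [_ oE] := quotient_abelem_prime nc neq_pq nsFH q'F nsFH pF ntF (normal_sub nsEH) abE ntE.
have [iCq _] := prime_normal_cent nsEH pr_q oE.
set C := 'C_(H / F)(E)%G in iCq.
have qC : q.-group C.
  apply/pgroupP=> r pr_r r_C; rewrite inE.
  have [x Cx ox] := Cauchy pr_r r_C; have [Hx cEx] := setIP Cx.
  have /orP[/eqP Dr | //] := pqHb r pr_r (dvdn_trans r_C (cardSg (subsetIl _ _))).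
  have [e Ee nte] := trivgPn _ ntE; have ncb := gk_nonadjacent_quotient F nc.
  have: x = 1.
    apply: (gk_nonadjacent_commute ncb neq_pq Hx (subsetP (normal_sub nsEH) e Ee)) nte.
    - by rewrite /p_elt ox Dr pnat_id.
    - exact: mem_p_elt (abelem_pgroup abE) Ee.
    by red; rewrite (centP cEx).
  by move/eqP; rewrite -order_eq1 ox => /eqP r1; rewrite r1 in pr_r.
have nsCH : C <| H / F by rewrite (normalS _ _ (subcent_normal _ _)) ?subsetIl // subsetI subxx normal_norm.
have hallC : q.-Sylow(H / F) C.
  rewrite /pHall subsetIl qC p'natE //; apply: contraL iCq => q_iC.
  apply/negP=> /(dvdn_trans q_iC); rewrite gtnNdvd //.
    by rewrite -subn1 subn_gt0 prime_gt1.
  by rewrite ltn_predL prime_gt0.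
have [Q sylQ] := Sylow_exists q H; have sQH := pHall_sub sylQ.
have nFQ := subset_trans sQH nFH.
have defC : Q / F = C.
  have sylQb := quotient_pHall nFQ sylQ.
  by apply/eqP; rewrite eqEcard (sub_normal_Hall hallC) ?quotientS ?quotient_pgroup ?(pHall_pgroup sylQ) //=
    (card_Hall hallC) (card_Hall sylQb).
have nsK : F <*> Q <| H.
  by rewrite -quotientYK // -[H in _ <| H](quotientGK nsFH) cosetpre_normal defC.
have sylQK : q.-Sylow(F <*> Q) Q.
  by apply: pHall_subl sylQ; rewrite ?joing_subr // normal_sub.
have defH : (F <*> Q) * 'N_H(Q) = H := Frattini_arg nsK sylQK.
have [p_N | p'N] := boolP (p %| #|'N_H(Q)|)%N.
  by apply/orP; left; apply/existsP; exists Q; rewrite sylQ.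
apply/orP; right; apply/existsP; exists F; apply/andP; split; last first.
  by rewrite (setIidPl nFH).
rewrite /pHall normal_sub // pF -card_quotient //.
have -> : H / F = 'N_H(Q) / F.
  rewrite -{1}defH norm_joinEr // -mulgA quotientMidl mulSGid //.
  by rewrite subsetI sQH normG.
by rewrite (pnat_dvd (dvdn_quotient _ _)) // p'natE.
Qed.

End SolvableOrders.

Section SolvableGraph.

Local Open Scope group_scope.

Implicit Types gT : finGroupType.

Lemma normalizes_Sylow_Hall gT (pi : nat_pred) (G H : {group gT}) p q :
  pi.-Hall(G) H -> q \in pi -> normalizes_Sylow H p q -> normalizes_Sylow G p q.
Proof.
move=> hallH pi_q /existsP[Q /andP[sylQ p_N]]; apply/existsP; exists Q.
rewrite (subHall_Sylow hallH pi_q sylQ) (dvdn_trans p_N) // cardSg // setSI //.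
exact: pHall_sub hallH.
Qed.

(** A Hall subgroup for [p] and [q] has a nontrivial [p]-core or [q]-core, and
    [normalizes_Sylow_pcore] applies to it. *)
Lemma normalizes_Sylow_total gT (G : {group gT}) p q :
    solvable G -> prime p -> prime q -> p != q -> gk_nonadjacent G p q ->
    (p %| #|G|)%N -> (q %| #|G|)%N ->
  normalizes_Sylow G p q || normalizes_Sylow G q p.
Proof.
move=> solG pr_p pr_q neq_pq nc p_G q_G.
pose pi : nat_pred := [pred r | (r == p) || (r == q)].
have [H hallH _] := Hall_exists_subJ pi solG; have sHG := pHall_sub hallH.
have [p_pi q_pi] : p \in pi /\ q \in pi by rewrite !inE !eqxx orbT.
have dvd_H r : r \in pi -> prime r -> (r %| #|G|)%N -> (r %| #|H|)%N.
  move=> pi_r pr_r r_G; rewrite (card_Hall hallH).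
  by rewrite -[r](part_pnat_id (_ : pi.-nat r)) ?pnatE // partn_dvd ?cardG_gt0.
have piH r : prime r -> (r %| #|H|)%N -> (r == p) || (r == q).
  by move=> pr_r r_H; have /pgroupP/(_ r pr_r r_H) := pHall_pgroup hallH.
have solH := solvableS sHG solG.
have ntH : H :!=: 1.
  by apply: contraTneq (dvd_H p p_pi pr_p p_G) => ->; rewrite cards1 Euclid_dvd1.
have [r [M [pr_r nsMH abM ntM]]] := solvable_minnormal solH ntH.
have rM := abelem_pgroup abM; have [_ r_M _] := pgroup_pdiv rM ntM.
have ntO : 'O_r(H) != 1.
  by apply: contraNneq ntM => O1; rewrite -subG1 -O1 pcore_max.
have ncH := gk_nonadjacentS sHG nc.
have: normalizes_Sylow H p q || normalizes_Sylow H q p.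
  have /orP[/eqP Dr | /eqP Dr] := piH r pr_r (dvdn_trans r_M (cardSg (normal_sub nsMH))).
    by rewrite Dr in ntO; apply: normalizes_Sylow_pcore => //; apply: dvd_H.
  rewrite Dr in ntO; rewrite orbC; apply: normalizes_Sylow_pcore => //.
  - by rewrite eq_sym.
  - by rewrite gk_nonadjacent_sym.
  - by move=> r1 pr_r1 r1_H; rewrite orbC piH.
  exact: dvd_H.
by case/orP=> /(normalizes_Sylow_Hall hallH)->; rewrite ?orbT.
Qed.

(** Let [N] be the largest normal subgroup of order prime to [c]. A minimal
    normal subgroup [E] of [G / N] has order [c] by [quotient_abelem_prime],
    because of the nontrivial [d]-core, and so it is centralised by the derived
    subgroup of [G / N]. Thus [B = [~: B, A]] centralises [E] modulo [N]; as no
    element has order [b * c], this forces [B] into [N]. Then the conjugates of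
    its subgroups, among them [X], are in [N], and so is [C = [~: C, X]],
    contrary to the choice of [N]. *)
Lemma no_path_after_pcore gT (G A B C X : {group gT}) b c d :
    solvable G -> prime c -> b != c -> c != d ->
    gk_nonadjacent G b c -> gk_nonadjacent G c d ->
    'O_d(G) != 1 -> (c %| #|G|)%N ->
    b.-Sylow(G) B -> A \subset G -> [~: B, A] = B ->
    c.-Sylow(G) C -> X \subset G -> b.-group X -> [~: C, X] = C ->
  False.
Proof.
move=> solG pr_c neq_bc neq_cd ncbc nccd ntO c_G sylB sAG defB sylC sXG bX defC.
set N := 'O_c^'(G)%G; have nsNG : N <| G := pcore_normal _ _.
have nNG := normal_norm nsNG; have c'N : ~~ (c %| #|N|)%N by rewrite -p'natE //; apply: pcore_pgroup.
have c_Gb : (c %| #|G / N|)%N.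
  move: c_G; rewrite -(Lagrange (normal_sub nsNG)) Euclid_dvdM // (negPf c'N).
  by rewrite card_quotient.
have ntGb : G / N != 1.
  by apply: contraTneq c_Gb => ->; rewrite cards1 Euclid_dvd1.
have [r [E [pr_r nsEG abE ntE]]] := solvable_minnormal (quotient_sol N solG) ntGb.
have rE := abelem_pgroup abE.
have {pr_r} Dr : r = c.
  apply: contraNeq ntE => neq_rc; rewrite -subG1 -(trivg_pcore_quotient c^' G).
  by rewrite pcore_max //; apply: sub_in_pnat rE => _ _ /eqnP->; rewrite !inE.
rewrite {r}Dr in abE rE.
have [sBG sCG] := (pHall_sub sylB, pHall_sub sylC).
have [||_ oE] := quotient_abelem_prime (_ : gk_nonadjacent G d c) _ nsNG c'N
  (pcore_normal d G) (pcore_pgroup d G) ntO (normal_sub nsEG) abE ntE.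
- by rewrite gk_nonadjacent_sym.
- by rewrite eq_sym.
have [_ sDer] := prime_normal_cent nsEG pr_c oE.
have [e Ee nte] := trivgPn _ ntE.
have sBN : B \subset N.
  rewrite -quotient_sub1 ?(subset_trans sBG) //; apply/subsetP=> x Bx.
  apply/set1P; have Gx := subsetP (quotientS N sBG) x Bx.
  apply: (gk_nonadjacent_commute (gk_nonadjacent_quotient N ncbc) neq_bc Gx) nte.
  - exact: subsetP (normal_sub nsEG) e Ee.
  - by apply: mem_p_elt Bx; rewrite quotient_pgroup // (pHall_pgroup sylB).
  - exact: mem_p_elt Ee.
  have: x \in 'C(E).
    apply: (subsetP sDer); apply: subsetP Bx; rewrite -defB quotientR ?(subset_trans _ nNG) //.
    by rewrite commgSS ?quotientS.
  by move/centP=> cEx; red; rewrite cEx.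
have sXN : X \subset N.
  have [x Gx sXB] := Sylow_Jsub sylB sXG bX.
  by rewrite -(conjSg _ _ x) (normsP nNG) // (subset_trans sXB).
have sCN : C \subset N by rewrite -defC (subset_trans (commgS _ sXN)) // commg_subr (subset_trans sCG).
case/negP: c'N; apply: dvdn_trans (cardSg sCN).
by rewrite (card_Hall sylC) -[c in (c %| _)%N](part_pnat_id (pnat_id pr_c)) partn_dvd.
Qed.

(** For an arrow from [p] to [q], a [p]-subgroup [X] acts without fixed points
    on a Sylow [q]-subgroup [Q], so that [[~: Q, X] = Q]; in this form the arrow
    passes to quotients. Let [N] be the largest normal subgroup of order prime
    to [d]. The group [G / N] has a nontrivial [d]-core. Its order is divisible
    by [c], since otherwise the arrow from [c] to [d] would put a Sylow
    [d]-subgroup into [N]. Now [no_path_after_pcore] applies to [G / N]. *)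
Lemma no_three_step_path gT (G : {group gT}) a b c d :
    solvable G -> prime a -> prime b -> prime c -> prime d ->
    a != b -> b != c -> c != d ->
    gk_nonadjacent G a b -> gk_nonadjacent G b c -> gk_nonadjacent G c d ->
    (d %| #|G|)%N ->
    normalizes_Sylow G a b -> normalizes_Sylow G b c -> normalizes_Sylow G c d ->
  False.
Proof.
move=> solG pr_a pr_b pr_c pr_d neq_ab neq_bc neq_cd nc_ab nc_bc nc_cd d_G.
have step p q : prime p -> prime q -> p != q -> gk_nonadjacent G p q -> normalizes_Sylow G p q ->
    exists Q X : {group gT}, [/\ q.-Sylow(G) Q, X \subset G, p.-group X & [~: Q, X] = Q].
  move=> pr_p pr_q neq_pq nc /existsP[Q /andP[sylQ p_N]].
  have [x /setIP[Gx Nx] ox] := Cauchy pr_p p_N.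
  exists Q, <[x]>%G; rewrite cycle_subG; split=> //; first by rewrite /pgroup -orderE ox pnat_id.
  apply: (gk_nonadjacent_commg nc) => //; rewrite ?(pHall_sub sylQ) ?(pHall_pgroup sylQ) //.
    by rewrite /p_elt ox pnat_id.
  by rewrite -order_gt1 ox prime_gt1.
move=> arr_ab arr_bc arr_cd.
have [B [A [sylB sAG _ defB]]] := step a b pr_a pr_b neq_ab nc_ab arr_ab.
have [C [X [sylC sXG bX defC]]] := step b c pr_b pr_c neq_bc nc_bc arr_bc.
have [D [Y [sylD sYG cY defD]]] := step c d pr_c pr_d neq_cd nc_cd arr_cd.
set N := 'O_d^'(G)%G; have nsNG : N <| G := pcore_normal _ _.
have nNG := normal_norm nsNG; have d'N : ~~ (d %| #|N|)%N by rewrite -p'natE //; apply: pcore_pgroup.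
have nN (K : {group gT}) : K \subset G -> K \subset 'N(N) by move=> sKG; apply: (subset_trans sKG).
have [sBG sCG sDG] : [/\ B \subset G, C \subset G & D \subset G].
  by split; [apply: pHall_sub sylB | apply: pHall_sub sylC | apply: pHall_sub sylD].
have d_Gb : (d %| #|G / N|)%N.
  move: d_G; rewrite -(Lagrange (normal_sub nsNG)) Euclid_dvdM // (negPf d'N).
  by rewrite card_quotient.
have ntGb : G / N != 1.
  by apply: contraTneq d_Gb => ->; rewrite cards1 Euclid_dvd1.
have [r [E [pr_r nsEG abE ntE]]] := solvable_minnormal (quotient_sol N solG) ntGb.
have rE := abelem_pgroup abE.
have {pr_r} Dr : r = d.
  apply: contraNeq ntE => neq_rd; rewrite -subG1 -(trivg_pcore_quotient d^' G).
  by rewrite pcore_max //; apply: sub_in_pnat rE => _ _ /eqnP->; rewrite !inE.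
rewrite {r}Dr in abE rE.
apply: (@no_path_after_pcore _ (G / N) (A / N) (B / N) (C / N) (X / N) b c d)%G => //;
  rewrite ?quotientS ?quotient_sol ?quotient_pHall ?quotient_pgroup ?gk_nonadjacent_quotient ?nN //.
- by apply: contraNneq ntE => O1; rewrite -subG1 -O1 pcore_max.
- apply: contraT => c'Gb; have sYN : Y \subset N.
    rewrite -quotient_sub1 ?nN //; rewrite subG1; apply: contraR c'Gb => ntYb.
    have [_ c_Yb _] := pgroup_pdiv (quotient_pgroup N cY) ntYb.
    exact: dvdn_trans c_Yb (cardSg (quotientS N sYG)).
  case/negP: d'N; have sDN : D \subset N.
    by rewrite -defD (subset_trans (commgS _ sYN)) // commg_subr nN.
  apply: dvdn_trans (cardSg sDN).
  by rewrite (card_Hall sylD) -[d in (d %| _)%N](part_pnat_id (pnat_id pr_d)) partn_dvd.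
- by rewrite -quotientR ?nN ?defB.
by rewrite -quotientR ?nN ?defC.
Qed.

End SolvableGraph.

(** * Triples of pairwise nonadjacent primes *)

Section Triangle.

Local Open Scope group_scope.

Implicit Types gT : finGroupType.

(** For [y] of order [r] in [L], the group [E <*> <[y]>] would be a Frobenius
    group acting without fixed points on [M]. The conjugates of [y] under [E]
    satisfy the conditions of [fpf_sum_expg], and the order of [E] is prime to
    that of [M]. *)
Lemma no_triangle_minnormal gT (G L M E : {group gT}) p q r :
    gk_nonadjacent G p q -> gk_nonadjacent G p r -> gk_nonadjacent G q r ->
    M \subset G -> L \subset G ->
    p.-abelem M -> M :!=: 1 -> L \subset 'N(M) ->
    E <| L -> q.-abelem E -> E :!=: 1 ->
    prime r -> (r %| #|L|)%N ->
    p != q -> p != r -> q != r ->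
  False.
Proof.
move=> nc_pq nc_pr nc_qr sMG sLG abM ntM nML nsEL abE ntE pr_r r_L.
move=> neq_pq neq_pr neq_qr; have [pM cMM _] := and3P abM; have [qE cEE _] := and3P abE.
have [sEL nEL] := andP nsEL; have sEG := subset_trans sEL sLG.
have [y Ly oy] := Cauchy pr_r r_L; have Gy := subsetP sLG y Ly.
have nt_r z : #[z] = r -> z != 1 by move=> oz; rewrite -order_gt1 oz prime_gt1.
have r_elt z : #[z] = r -> r.-elt z by move=> oz; rewrite /p_elt oz pnat_id.
have [v Mv ntv] := trivgPn _ ntM; have [e Ee nte] := trivgPn _ ntE.
have sub_e : 'C_M(E) \subset 'C_M[e] by rewrite setIS // -cent_set1 centS ?sub1set.
have vE1 : v ^+ #|E| = 1.
  apply: (fpf_sum_expg cMM (f := fun x => y ^ x) (r := r) (y := y)) => //.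
  - exact: prime_gt0.
  - exact: subset_trans nML.
  - exact: (subsetP nML).
  - apply/trivgP; apply: subset_trans sub_e _.
    rewrite (@gk_nonadjacent_cent1 _ G M q p) //; rewrite ?(subsetP sEG) //.
    + by rewrite gk_nonadjacent_sym.
    + by rewrite eq_sym.
    exact: mem_p_elt Ee.
  - move=> x Ex; have Lx := subsetP sEL x Ex; have Lyx := groupJ Ly Lx.
    split; first exact: (subsetP nML).
      by rewrite -conjXg -oy expg_order conj1g.
    apply: (@gk_nonadjacent_cent1 _ G M r p); rewrite ?(subsetP sLG) ?nt_r ?r_elt ?orderJ //.
      by rewrite gk_nonadjacent_sym.
    by rewrite eq_sym.
  - move=> j /andP[j_gt0 lt_jr] x w Ex Ew /=; rewrite -!conjXg => eq_xw.
    apply/eqP; rewrite eq_mulgV1; apply/eqP.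
    apply: (@gk_nonadjacent_commute _ G q r _ (y ^+ j)) => //; rewrite ?groupX //.
    + by rewrite groupM ?groupV ?(subsetP sEG).
    + by rewrite (mem_p_elt qE) // groupM ?groupV.
    + by rewrite p_eltX ?r_elt.
    + by apply/commute_sym/commgP/conjg_fixP; rewrite conjgM eq_xw conjgK.
    by rewrite -order_dvdn oy gtnNdvd.
  move=> j x _ Ex; rewrite -conjXg mem_rcoset.
  have -> : (y ^+ j) ^ x * (y ^+ j)^-1 = x^-1 * x ^ (y ^+ j)^-1.
    by rewrite !conjgE invgK !mulgA.
  by rewrite groupM ?groupV // memJ_norm // groupV groupX // (subsetP nEL).
case/eqP: ntv; apply/eqP; rewrite -order_eq1 -dvdn1.
have /eqP <- : coprime #[v] #|E|.
  apply: pnat_coprime (mem_p_elt pM Mv) _; apply: sub_in_pnat qE => s _ /eqnP->.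
  by rewrite !inE eq_sym.
by rewrite dvdn_gcd dvdnn /= order_dvdn vE1.
Qed.

(** A Hall subgroup for [q] and [r] acts on [M], and it has a nontrivial normal
    elementary abelian [q]-subgroup or [r]-subgroup. *)
Lemma no_triangle_normal gT (G M : {group gT}) p q r :
    solvable G -> prime q -> prime r -> p != q -> p != r -> q != r ->
    gk_nonadjacent G p q -> gk_nonadjacent G p r -> gk_nonadjacent G q r ->
    (q %| #|G|)%N -> (r %| #|G|)%N ->
    M <| G -> p.-abelem M -> M :!=: 1 ->
  False.
Proof.
move=> solG pr_q pr_r neq_pq neq_pr neq_qr nc_pq nc_pr nc_qr q_G r_G nsMG abM ntM.
pose pi : nat_pred := [pred s | (s == q) || (s == r)].
have [L hallL _] := Hall_exists_subJ pi solG; have sLG := pHall_sub hallL.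
have dvd_L s : s \in pi -> prime s -> (s %| #|G|)%N -> (s %| #|L|)%N.
  move=> pi_s pr_s s_G; rewrite (card_Hall hallL).
  by rewrite -[s](part_pnat_id (_ : pi.-nat s)) ?pnatE // partn_dvd ?cardG_gt0.
have [q_L r_L] : (q %| #|L|)%N /\ (r %| #|L|)%N.
  by rewrite !dvd_L ?inE ?eqxx ?orbT.
have ntL : L :!=: 1 by apply: contraTneq q_L => ->; rewrite cards1 Euclid_dvd1.
have [s [E [pr_s nsEL abE ntE]]] := solvable_minnormal (solvableS sLG solG) ntL.
have [_ s_E _] := pgroup_pdiv (abelem_pgroup abE) ntE.
have pi_s : s \in pi.
  by have /pgroupP := pHall_pgroup hallL; apply=> //; apply: dvdn_trans s_E (cardSg (normal_sub nsEL)).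
have nML := subset_trans sLG (normal_norm nsMG).
have sMG := normal_sub nsMG; have nc_rq := nc_qr; rewrite gk_nonadjacent_sym in nc_rq.
have neq_rq := neq_qr; rewrite eq_sym in neq_rq.
case/orP: pi_s => /eqP Ds; rewrite Ds in abE.
  exact: (no_triangle_minnormal nc_pq nc_pr nc_qr sMG sLG abM ntM nML nsEL abE).
exact: (no_triangle_minnormal nc_pr nc_pq nc_rq sMG sLG abM ntM nML nsEL abE).
Qed.

(** A Hall subgroup for [p], [q] and [r] has a nontrivial normal elementary
    abelian subgroup for one of these primes; the two others then play the part
    of [q] and [r] in [no_triangle_normal]. *)
Lemma solvable_no_triangle gT (G : {group gT}) p q r :
    solvable G -> prime p -> prime q -> prime r -> p != q -> p != r -> q != r ->
    gk_nonadjacent G p q -> gk_nonadjacent G p r -> gk_nonadjacent G q r ->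
    (p %| #|G|)%N -> (q %| #|G|)%N -> (r %| #|G|)%N ->
  False.
Proof.
move=> solG pr_p pr_q pr_r neq_pq neq_pr neq_qr nc_pq nc_pr nc_qr p_G q_G r_G.
pose pi : nat_pred := [pred s | [|| s == p, s == q | s == r]].
have [L hallL _] := Hall_exists_subJ pi solG; have sLG := pHall_sub hallL.
have dvd_L s : s \in pi -> prime s -> (s %| #|G|)%N -> (s %| #|L|)%N.
  move=> pi_s pr_s s_G; rewrite (card_Hall hallL).
  by rewrite -[s](part_pnat_id (_ : pi.-nat s)) ?pnatE // partn_dvd ?cardG_gt0.
have [p_L [q_L r_L]] : (p %| #|L|)%N /\ (q %| #|L|)%N /\ (r %| #|L|)%N.
  by rewrite !dvd_L ?inE ?eqxx ?orbT.
have ntL : L :!=: 1 by apply: contraTneq q_L => ->; rewrite cards1 Euclid_dvd1.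
have solL := solvableS sLG solG.
have [s [M [pr_s nsML abM ntM]]] := solvable_minnormal solL ntL.
have [_ s_M _] := pgroup_pdiv (abelem_pgroup abM) ntM.
have pi_s : s \in pi.
  by have /pgroupP := pHall_pgroup hallL; apply=> //; apply: dvdn_trans s_M (cardSg (normal_sub nsML)).
have nc p1 p2 : gk_nonadjacent G p1 p2 -> gk_nonadjacent L p1 p2 /\ gk_nonadjacent L p2 p1.
  by rewrite [gk_nonadjacent L p2 _]gk_nonadjacent_sym; split; apply: gk_nonadjacentS sLG _.
have [[ncL_pq ncL_qp] [[ncL_pr ncL_rp] [ncL_qr ncL_rq]]] := (nc _ _ nc_pq, (nc _ _ nc_pr, nc _ _ nc_qr)).
case/or3P: pi_s => /eqP Ds; rewrite Ds in abM.
- exact: no_triangle_normal solL pr_q pr_r _ _ _ _ _ _ _ _ nsML abM ntM.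
- by apply: no_triangle_normal solL pr_p pr_r _ _ _ _ _ _ _ _ nsML abM ntM; rewrite // eq_sym.
by apply: no_triangle_normal solL pr_p pr_q _ _ _ _ _ _ _ _ nsML abM ntM; rewrite // eq_sym.
Qed.

End Triangle.

(** * The complement of the codegree graph *)

Section Forward.

Variables (gT : finGroupType) (G : {group gT}).
Hypothesis solG : solvable G.

Lemma cod_vertex_dvd p : cod_vertex G p -> prime p /\ (p %| #|G|)%N.
Proof.
case/andP=> pr_p /hasP[_ /mapP[_ /irrP[i ->] ->] p_cod]; split=> //.
exact: dvdn_trans (dvd_codegree_index p_cod) (dvdn_indexg _ _).
Qed.

Lemma order_exp_divn (z : gT) p : (0 < p)%N -> (p %| #[z]%g)%N ->
  #[z ^+ (#[z]%g %/ p)]%g = p.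
Proof.
move=> p_gt0 p_z; rewrite orderXdiv ?dvdn_div //.
by rewrite divnA // mulKn.
Qed.

Lemma cod_gk_nonadjacent p q :
    prime p -> prime q -> p != q ->
    ~~ has (fun c => ((p * q)%N %| c)%C) (codegrees G) ->
  gk_nonadjacent G p q.
Proof.
move=> pr_p pr_q neq_pq; apply: contraR => /forall_inPn[z Gz]; rewrite negbK => pq_z.
have p_z := dvdn_trans (dvdn_mulr q (dvdnn p)) pq_z.
have q_z := dvdn_trans (dvdn_mull p (dvdnn q)) pq_z.
have [||i pq_i] := codegree_prime_orders pr_p pr_q neq_pq (groupX (#[z]%g %/ p) Gz)
  (groupX (#[z]%g %/ q) Gz) (commuteX2 _ _ (commute_refl z)).
- by rewrite order_exp_divn ?prime_gt0.
- by rewrite order_exp_divn ?prime_gt0.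
apply/hasP; exists (codegree 'chi[G]_i) => //.
by apply: map_f; apply: mem_irr.
Qed.

Variables (T : finType) (e : rel T) (P : T -> nat).
Hypotheses (P_vertex : forall t, prime (P t) /\ (P t %| #|G|)%N).
Hypothesis P_edge : forall t u, complement e t u -> P t != P u /\ gk_nonadjacent G (P t) (P u).
Hypothesis e_sym : symmetric e.

Lemma complement_triangle_free : triangle_free (complement e).
Proof.
move=> x y z; apply/and3P=> -[xy yz xz].
have [[neq_xy nc_xy] [neq_yz nc_yz]] := (P_edge xy, P_edge yz).
have [neq_xz nc_xz] := P_edge xz.
have [[pr_x x_G] [[pr_y y_G] [pr_z z_G]]] := (P_vertex x, (P_vertex y, P_vertex z)).
exact: (solvable_no_triangle solG pr_x pr_y pr_z).
Qed.

(** Orient the nonadjacent pairs by [normalizes_Sylow]. Vertices without incoming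
    arrow get colour 0, the others colour 1 or 2 according to whether they have
    an outgoing arrow or not. The ends of an arrow get the same colour only if
    both have colour 1, and then the arrow is the middle of a path of three
    arrows. *)
Lemma complement_colorable : colorable 3 (complement e).
Proof.
pose arrow t u := complement e t u && normalizes_Sylow G (P t) (P u).
pose c (t : T) : 'I_3 :=
  if ~~ [exists u, arrow u t] then inord 0
  else if [exists u, arrow t u] then inord 1 else inord 2.
have c_arrow t u : arrow t u -> c t != c u.
  move=> tu; have out_t : [exists u, arrow t u] by apply/existsP; exists u.
  have in_u : [exists t, arrow t u] by apply/existsP; exists t.
  rewrite /c in_u out_t /=; case: ifP => [_|/negbFE/existsP[s st]].
    by case: ifP => _; rewrite -(inj_eq val_inj) /= !inordK.
  case: ifP => [/existsP[v uv] | _]; last by rewrite -(inj_eq val_inj) /= !inordK.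
  have [[/P_edge[neq_st nc_st] arr_st] [/P_edge[neq_tu nc_tu] arr_tu]] := (andP st, andP tu).
  have [/P_edge[neq_uv nc_uv] arr_uv] := andP uv.
  have pr x : prime (P x) by case: (P_vertex x).
  have [_ v_G] := P_vertex v.
  by case: (no_three_step_path solG (pr s) (pr t) (pr u) (pr v) neq_st neq_tu neq_uv).
exists c; move=> t u tu; have [neq_tu nc_tu] := P_edge tu.
have [[pr_t t_G] [pr_u u_G]] := (P_vertex t, P_vertex u).
have [t_u | u_t] := orP (normalizes_Sylow_total solG pr_t pr_u neq_tu nc_tu t_G u_G).
  by apply: c_arrow; rewrite /arrow tu.
rewrite eq_sym; apply: c_arrow; rewrite /arrow u_t andbT.
by move: tu; rewrite /complement /= eq_sym e_sym.
Qed.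

End Forward.

Lemma cod_graph_complement (T : finType) (e : rel T) (gT : finGroupType) (G : {group gT}) :
    symmetric e -> solvable G -> graph_iso e (@cod_graph gT G) ->
  colorable 3 (complement e) /\ triangle_free (complement e).
Proof.
move=> e_sym solG [h /bij_inj h_inj h_mono]; pose P t := val (h t).
have P_vertex t : prime (P t) /\ (P t %| #|G|)%N := cod_vertex_dvd (valP (h t)).
have P_edge t u : complement e t u -> P t != P u /\ gk_nonadjacent G (P t) (P u).
  case/andP=> neq_tu; rewrite -h_mono negb_and negbK.
  have neq_P : P t != P u by rewrite (inj_eq val_inj) (inj_eq h_inj).
  rewrite (negPf neq_P) /= => no_pq; split=> //.
  have [[pr_t _] [pr_u _]] := (P_vertex t, P_vertex u).
  exact: cod_gk_nonadjacent pr_t pr_u neq_P no_pq.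
split; first exact: (complement_colorable solG P_vertex P_edge e_sym).
exact: (complement_triangle_free solG P_vertex P_edge).
Qed.

(** * Primes with prescribed congruences *)

(** For [n > 1], let [q] be a prime divisor of the value at [3 * n] of the [n]-th
    cyclotomic polynomial. It divides [(3 * n) ^ n - 1], hence not [n], so that
    ['X^n - 1] is separable modulo [q] and [3 * n] is not a root modulo [q] of
    the [d]-th cyclotomic polynomial for any other divisor [d] of [n]. Thus
    [3 * n] has order [n] modulo [q]. *)
Lemma prime_eq1_mod (n : nat) : (0 < n)%N -> exists2 q : nat, prime q & (n %| q.-1)%N.
Proof.
case: n => [|[_|n0 n_gt0]] //; [by exists 2 | move: n0.+2 (isT : 1 < n0.+2)%N n_gt0 => n n_gt1 n_gt0].
pose x : int := (n * 3)%:Z; set v := ('Phi_n).[x].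
(* Each factor [3 * n - z ^ k] of [v] over the complex numbers has absolute
   value at least [3 * n - 1]. *)
have v_gt1 : (1 < `|v|)%N.
  have [z prim_z] := C_prim_root_exists n_gt0.
  have z_norm k : `|z ^+ k| = 1 :> algC.
    apply/eqP; rewrite -(pexpr_eq1 n_gt0) // -normrX exprAC.
    by rewrite (prim_expr_order prim_z) expr1n normr1.
  have factor k : 2 <= `|x%:~R - z ^+ k| :> algC.
    have := lerB_dist (x%:~R : algC) (z ^+ k); rewrite z_norm; apply: le_trans.
    rewrite /x -pmulrn normr_nat lerBrDr -(natrD _ 2 1) ler_nat.
    by rewrite leq_pmull.
  have : 1 < `|v%:~R| :> algC.
    have -> : v%:~R = (cyclotomic z n).[x%:~R] by rewrite -(Cintr_Cyclotomic prim_z) horner_map.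
    rewrite horner_prod normr_prod (bigD1 (Ordinal n_gt1)) /= ?coprime1n //.
    rewrite hornerXsubC (lt_le_trans (_ : 1 < 2)) ?ltr1n //.
    rewrite -[X in X <= _]mulr1 ler_pM ?ler0n ?ler01 //.
    elim/big_ind: _ => // [a b a_ge1 b_ge1 | k _]; first exact: mulr_ege1.
    by rewrite hornerXsubC (le_trans _ (factor k)) ?ler1n.
  by rewrite -intr_norm ltr1z -abszE.
set q := pdiv `|v|; have pr_q : prime q by apply: pdiv_prime.
exists q => //.
have pchar_q := pchar_Fp pr_q.
have vq : (v%:~R : 'F_q) = 0.
  have : (`|v|%N%:R : 'F_q) == 0 by rewrite -(dvdn_pcharf pchar_q) pdiv_dvd.
  by rewrite {2}[v]intEsign rmorphM /= -pmulrn => /eqP->; rewrite mulr0.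
pose ph (p : {poly int}) := map_poly (intr : int -> 'F_q) p.
pose y : 'F_q := x%:~R.
have root_y : root (ph 'Phi_n) y.
  by rewrite /root /ph /y horner_map /= vq.
have prodPhi m : (0 < m)%N -> \prod_(d <- divisors m) ph 'Phi_d = 'X^m - 1.
  move=> m_gt0; rewrite /ph -rmorph_prod prod_Cyclotomic // rmorphB /= map_polyXn.
  by rewrite rmorph1.
have Phi_dvd d m : (0 < m)%N -> (d %| m)%N ->
    exists r, 'X^m - 1 = ph 'Phi_d * r.
  move=> m_gt0 d_m; rewrite -prodPhi // (big_rem d) -?dvdn_divisors //=.
  by exists (\prod_(y <- rem d (divisors m)) ph 'Phi_y).
have yn1 : y ^+ n = 1.
  have [r Dr] := Phi_dvd n n n_gt0 (dvdnn n).
  apply/eqP; rewrite -subr_eq0; have := congr1 (horner^~ y) Dr => /=.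
  by rewrite !hornerE (eqP root_y) mul0r => ->.
have nz_n : n%:R != 0 :> 'F_q.
  apply: contra_eqN yn1 => nz; rewrite /y /x -pmulrn natrM (eqP nz) mul0r.
  by rewrite expr0n eqn0Ngt n_gt0 eq_sym oner_eq0.
have sep : separable_poly ('X^n - 1 : {poly 'F_q}) by rewrite separable_Xn_sub_1.
have [m prim_y m_n] := prim_order_exists n_gt0 yn1.
have [lt_mn | ] := ltnP m n; last first.
  rewrite leq_eqVlt ltnNge dvdn_leq // orbF => /eqP Dn.
  rewrite Dn (prim_order_dvd prim_y).
  have nz_y : y != 0.
    by apply: contra_eq_neq yn1 => ->; rewrite expr0n eqn0Ngt n_gt0 eq_sym oner_neq0.
  apply/eqP/(mulfI nz_y); rewrite -exprS prednK ?prime_gt0 // mulr1.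
  by rewrite -{2}[y]expf_card card_Fp.
have m_gt0 := prim_order_gt0 prim_y.
have : root (\prod_(d <- divisors m) ph 'Phi_d) y.
  by rewrite prodPhi // /root !hornerE (prim_expr_order prim_y) subrr.
rewrite /root horner_prod prodf_seq_eq0 => /hasP[d]; rewrite -dvdn_divisors // => d_m root_d.
have neq_dn : d != n by rewrite neq_ltn (leq_ltn_trans _ lt_mn) // dvdn_leq.
have rem_d : d \in rem n (divisors n).
  by rewrite mem_rem_uniq ?divisors_uniq // !inE neq_dn -dvdn_divisors // (dvdn_trans d_m).
move: sep; rewrite -prodPhi // (big_rem n) -?dvdn_divisors //= (big_rem d) //=.
rewrite separable_mul => /and3P[_ _]; rewrite coprimepMr => /andP[co _].
by case/negP: (coprimep_root co root_y).
Qed.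

(** Each new prime is taken congruent to 1 modulo the product of the previous
    ones. *)
Lemma primes_pairwise_eq1_mod (T : eqType) (s : seq T) : uniq s ->
  exists2 r : T -> nat, {in s, forall t, prime (r t)}
    & pairwise (fun t u => r t %| (r u).-1)%N s.
Proof.
elim/last_ind: s => [|s u IHs]; first by exists (fun=> 2).
rewrite rcons_uniq => /andP[s'u /IHs[r pr_r mod_r]].
have n_gt0 : (0 < \prod_(t <- s) r t)%N.
  by rewrite big_seq prodn_cond_gt0 // => t /pr_r/prime_gt0.
have [q pr_q n_q] := prime_eq1_mod n_gt0.
pose r' t := if t == u then q else r t.
have r's t : t \in s -> r' t = r t.
  by rewrite /r'; case: eqP => // ->; rewrite (negPf s'u).
exists r' => [t|]; first by rewrite mem_rcons inE /r'; case: eqP => //= _; apply: pr_r.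
rewrite pairwise_rcons; apply/andP; split.
  apply/allP=> t s_t; rewrite (r's t) // /r' eqxx; apply: dvdn_trans n_q.
  by rewrite (big_rem t) //= dvdn_mulr.
apply: etrans mod_r; apply: (eq_in_pairwise (P := mem s)) (allss _).
by move=> x y xs ys; rewrite /= !r's.
Qed.

(** The primes are chosen one after another, in the order of increasing colours.
    They are distinct, since a prime [r] does not divide [r - 1]. *)
Lemma coloured_primes (T : finType) (c : T -> nat) :
  exists2 r : T -> nat, (forall t, prime (r t)) /\ injective r
    & forall t u, (c t < c u)%N -> (r t %| (r u).-1)%N.
Proof.
pose le_c t u := (c t <= c u)%N.
have tot : total le_c by move=> t u; apply: leq_total.
have trc : transitive le_c by move=> t u v; apply: leq_trans.
pose s := sort le_c (enum T); have s_t t : t \in s by rewrite mem_sort mem_enum.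
have uniq_s : uniq s by rewrite sort_uniq enum_uniq.
have [r pr_r mod_r] := primes_pairwise_eq1_mod uniq_s.
have sorted_s : pairwise le_c s by rewrite -sorted_pairwise // sort_sorted.
have dvd_r t u : (index t s < index u s)%N -> (r t %| (r u).-1)%N.
  move=> lt_tu; have /(pairwiseP t)/(_ (index t s) (index u s)) := mod_r.
  by rewrite !inE !index_mem !nth_index //; apply.
have ndvd p : prime p -> (p %| p.-1)%N = false.
  by case: p => [|[|p]] // _; rewrite gtnNdvd.
exists r; first split=> [t | t u eq_r]; first exact: pr_r.
  have [lt_tu | lt_ut | eq_tu] := ltngtP (index t s) (index u s).
  - by have := dvd_r _ _ lt_tu; rewrite eq_r ndvd // pr_r.
  - by have := dvd_r _ _ lt_ut; rewrite eq_r ndvd // pr_r.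
  by rewrite -(nth_index t (s_t t)) eq_tu nth_index.
move=> t u lt_c; apply: dvd_r; rewrite ltnNge; apply: contraL lt_c => le_ut.
rewrite -leqNgt; move: le_ut; rewrite leq_eqVlt => /orP[/eqP eq_ut | lt_ut].
  by rewrite -(nth_index t (s_t t)) -eq_ut nth_index.
have /(pairwiseP t)/(_ (index u s) (index t s)) := sorted_s.
by rewrite !inE !index_mem !nth_index //; apply.
Qed.

(** * Codegrees not divisible by p q *)

Section NonadjacencyCriterion.

Variables (gT : finGroupType) (G : {group gT}) (i : Iirr G).

(** By Clifford's theorem, the degree of ['chi_i] is [e * |G : I| * 'chi_j 1],
    where [I] is the inertia group and [e] the multiplicity of ['chi_j]. Hence
    [|I|] is the product of the codegree, [e], ['chi_j 1] and the order of the
    kernel. *)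
Lemma codegree_dvd_inertia (N : {group gT}) (j : Iirr N) (d : nat) :
    N <| G -> j \in irr_constt ('Res[N] 'chi_i) -> (d %| codegree 'chi_i)%C ->
  (d %| #|'I_G['chi_j]|)%N.
Proof.
move=> nsNG chiNj; have /natrP[n Dn] := codegree_nat i; rewrite Dn dvdC_nat => d_n.
have /natrP[m Dm] := Cnat_irr1 j.
have /natrP[e De] : '['Res[N] 'chi_i, 'chi_j] \in Num.nat.
  by rewrite Cnat_cfdot_char ?cfRes_char ?irr_char.
have D1 : 'chi_i 1%g = (e * (#|G : 'I_G['chi_j]| * m))%:R.
  rewrite -(cfResE _ (normal_sub nsNG)) // {1}(Clifford_Res_sum_cfclass nsNG chiNj).
  rewrite cfunE sum_cfunE De natrM; congr (_ * _).
  rewrite natrM -size_cfclass mulr_natl -[size _]card_ord big_tnth -sumr_const -Dm.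
  by apply: eq_bigr => k _; have /cfclassP[y Gy ->] := mem_tnth k (in_tuple _); rewrite cfConjg1.
have DG : (#|G| = n * (e * (#|G : 'I_G['chi_j]| * m)) * #|cfker 'chi_i|)%N.
  rewrite -(Lagrange (cfker_sub 'chi_i)) mulnC; congr (_ * _)%N.
  apply/eqP; rewrite -eqC_nat natrM -Dn -D1 /codegree.
  by rewrite divfK ?irr1_neq0.
have sIG : 'I_G['chi_j] \subset G := Inertia_sub _ _.
rewrite -(dvdn_pmul2r (indexg_gt0 G 'I_G['chi_j])) (Lagrange sIG) DG.
rewrite [(_ * m)%N]mulnC !mulnA [X in (_ %| X)%N]mulnAC dvdn_mul // -!mulnA.
exact: dvdn_mulr.
Qed.

Lemma sub_cfker_constt (N A : {group gT}) : N <| G -> A \subset N ->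
    {in irr_constt ('Res[N] 'chi_i), forall j, A \subset cfker 'chi_j} ->
  A \subset cfker 'chi_i.
Proof.
move=> nsNG sAN kerA; have sNG := normal_sub nsNG.
have: A \subset cfker ('Res[N] 'chi_i).
  rewrite cfkerE ?cfRes_char ?irr_char // subsetI sAN.
  by apply/bigcapsP=> j /kerA.
by rewrite cfker_Res ?irr_char // subsetI => /andP[].
Qed.

(** The constituents [theta] of ['chi_i] on [M] are linear. If [p] divides the
    codegree, some [x] of order [p] fixes [theta], whose kernel then contains
    [[~: M, <[x]>]]. So the values of [theta] are values on [V], of order prime
    to [q], and the kernel of [theta] contains the [q]-elements of [M]. As this
    holds for all [theta], the kernel of ['chi_i] contains a Sylow [q]-subgroup
    of [M], hence of [G], and [q] does not divide the codegree. *)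
Lemma regular_section_codegree (M V : {group gT}) (p q : nat) :
    prime p -> prime q -> M <| G -> (M^`(1) \subset cfker 'chi_i)%g -> V \subset M ->
    ~~ (q %| #|V|)%N -> ~~ (q %| #|G : M|)%N ->
    {in G, forall x, #[x]%g = p -> M \subset ([~: M, <[x]>] * V)%g} ->
  ~~ ((p %| codegree 'chi_i)%C && (q %| codegree 'chi_i)%C).
Proof.
move=> pr_p pr_q nsMG kerM' sVM q'V q'iM regM; apply/andP=> -[p_cod q_cod].
have [Q sylQ] := Sylow_exists q M; have sMG := normal_sub nsMG.
have [sQM qQ q'iQ] := and3P sylQ.
suffices sQK : Q \subset cfker 'chi_i.
  have := dvd_codegree_index q_cod; apply/negP; rewrite -p'natE //.
  apply: pnat_dvd (indexgS _ sQK) _; rewrite -(Lagrange_index sMG sQM) pnatM.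
  by rewrite p'natE // q'iM.
apply: (sub_cfker_constt nsMG sQM) => j chiMj.
have lin_j : 'chi_j \is a linear_char.
  rewrite lin_irr_der1; apply: subset_trans (cfker_constt _ chiMj); last first.
    by rewrite cfRes_char ?irr_char.
  by rewrite cfker_Res ?irr_char // subsetI der_sub.
have [x Ix ox] := Cauchy pr_p (codegree_dvd_inertia nsMG chiMj p_cod).
have [Gx Igx] := setIP Ix.
have sRK : [~: M, <[x]>]%g \subset cfker 'chi_j.
  rewrite gen_subG; apply/subsetP=> _ /imset2P[m z Mm xz ->].
  have Iz : z \in 'I['chi_j]%g by apply: subsetP xz; rewrite cycle_subG.
  have nMz := subsetP (norm_inertia 'chi_j) z Iz.
  suffices: 'chi_j [~ m, z]%g == 'chi_j 1%g by rewrite /= cfkerEirr inE.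
  rewrite commgEl lin_charM ?groupV ?memJ_norm // lin_charV //.
  by rewrite inertia_valJ // mulVf ?lin_char_neq0 // lin_char1.
apply/subsetP=> y Qy; have My := subsetP sQM y Qy.
have /mulsgP[u v Ru Vv Dy] := subsetP (regM x Gx ox) y My.
have Mv := subsetP sVM v Vv.
have jy : 'chi_j y = 'chi_j v by rewrite Dy cfkerMl // (subsetP sRK).
have co : coprime #[y]%g #|V|.
  by apply: pnat_coprime (mem_p_elt qQ Qy) _; rewrite p'natE.
have Kyn : (y ^+ #|V|)%g \in cfker 'chi_j.
  by rewrite cfkerEirr inE lin_char1 // lin_charX // jy -lin_charX // expg_cardG ?lin_char1.
have: generator <[y]>%g (y ^+ #|V|)%g by rewrite generator_coprime.
by rewrite -cycle_subG => /eqP genE; rewrite genE cycle_subG.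
Qed.

(** Here [M = Q] and [V = 1], as [[~: Q, <[x]>] = Q] if [x] has no fixed points. *)
Lemma normal_abelian_Sylow_codegree (Q : {group gT}) (p q : nat) :
    prime p -> prime q -> Q <| G -> abelian Q -> ~~ (q %| #|G : Q|)%N ->
    {in G, forall x, #[x]%g = p -> 'C_Q[x]%g = 1%g} ->
  ~~ ((p %| codegree 'chi_i)%C && (q %| codegree 'chi_i)%C).
Proof.
move=> pr_p pr_q nsQG abQ q'iQ regQ.
apply: (regular_section_codegree pr_p pr_q nsQG _ (sub1G Q)) => // [||x Gx ox].
- by rewrite (derG1P abQ) sub1G.
- by rewrite cards1 Euclid_dvd1.
by rewrite mulg1 commg_regular ?regQ // (subsetP (normal_norm nsQG)).
Qed.

(** If [q] divides the codegree, then each constituent of ['chi_i] on [V] is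
    fixed by an element of order [q], which is in [M] but not in [V], and so it
    is fixed by [M]. Hence the kernel of ['chi_i] contains [[~: V, M]]. As
    [M / V] is cyclic, it even contains the derived subgroup of [M], which is
    what [regular_section_codegree] asks for. *)
Lemma prime_section_codegree (M V : {group gT}) (p q : nat) :
    prime p -> prime q -> V <| G -> M <| G -> V \subset M -> abelian V ->
    ~~ (q %| #|V|)%N -> #|M : V| = q -> ~~ (q %| #|G : M|)%N ->
    {in G, forall x, #[x]%g = p -> M \subset ([~: M, <[x]>] * V)%g} ->
  ~~ ((p %| codegree 'chi_i)%C && (q %| codegree 'chi_i)%C).
Proof.
move=> pr_p pr_q nsVG nsMG sVM abV q'V iMV q'iM regM.
apply/negP=> cod_pq; have [p_cod q_cod] := andP cod_pq; move: cod_pq; apply/negP.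
apply: (regular_section_codegree pr_p pr_q nsMG _ sVM) => //.
have sMG := normal_sub nsMG; have sVG := normal_sub nsVG.
have nVM : M \subset 'N(V) := subset_trans sMG (normal_norm nsVG).
have defM y : y \in M -> y \notin V -> V <*> <[y]>%g = M :> {set gT}.
  move=> My notVy; set J := V <*> <[y]>%g.
  have sVJ : V \subset J by apply: joing_subl.
  have sJM : J \subset M by rewrite join_subG sVM cycle_subG.
  have: (#|J : V| %| q)%N by rewrite -iMV -(Lagrange_index sJM sVJ) dvdn_mull.
  case/primeP: (pr_q) => _ dvq /dvq/orP[/eqP i1 | /eqP iq].
    case/negP: notVy; have: J \subset V by rewrite -indexg_eq1 i1.
    by move/subsetP; apply; rewrite mem_gen // inE cycle_id orbT.
  apply/eqP; rewrite eqEsubset sJM -indexg_eq1 /=.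
  have := Lagrange_index sJM sVJ; rewrite iq iMV => /eqP.
  by rewrite -{2}[q]mul1n eqn_pmul2r ?prime_gt0.
have inertM j : j \in irr_constt ('Res[V] 'chi_i) -> M \subset 'I['chi_j]%g.
  move=> chiVj; have q_I := codegree_dvd_inertia nsVG chiVj q_cod.
  have [y Iy oy] := Cauchy pr_q q_I; have [Gy Ijy] := setIP Iy.
  have My : y \in M.
    apply: coset_idr; first exact: subsetP (normal_norm nsMG) y Gy.
    apply/eqP; rewrite -order_eq1; apply: contraR q'iM => nt.
    have <- : #[coset M y]%g = q.
      apply: prime_nt_dvdP => //; rewrite -oy morph_order //.
      exact: subsetP (normal_norm nsMG) y Gy.
    by rewrite -card_quotient ?normal_norm // order_dvdG // mem_quotient.
  have notVy : y \notin V by apply: contra q'V => Vy; rewrite -oy order_dvdG.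
  by rewrite -(defM y My notVy) join_subG sub_inertia cycle_subG.
have [z Mz notVz] : exists2 z, z \in M & z \notin V.
  apply/subsetPn; apply: contraL (prime_gt1 pr_q) => sMV.
  by rewrite -iMV (eqP (_ : #|M : V| == 1%N)) ?indexg_eq1.
have sRK : [~: V, M]%g \subset cfker 'chi_i.
  have sRV : [~: V, M]%g \subset V by rewrite commg_subl.
  apply: (sub_cfker_constt nsVG sRV) => j chiVj.
  have lin_j : 'chi_j \is a linear_char by apply/char_abelianP.
  rewrite gen_subG; apply/subsetP=> _ /imset2P[v m Vv Mm ->].
  have Im := subsetP (inertM j chiVj) m Mm.
  suffices: 'chi_j [~ v, m]%g == 'chi_j 1%g by rewrite /= cfkerEirr inE.
  rewrite commgEl lin_charM ?groupV ?memJ_norm ?(subsetP nVM) // lin_charV //.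
  by rewrite inertia_valJ // mulVf ?lin_char_neq0 // lin_char1.
apply: subset_trans sRK; apply: der1_min; first exact: commg_normr.
have nRM : M \subset 'N([~: V, M]%G) := commg_normr _ _.
have sRz : [~: <[z]>, V]%g \subset [~: V, M]%G by rewrite /= commGC commgS ?cycle_subG.
move: [~: V, M]%G nRM sRz => R nRM sRz.
rewrite -(defM z Mz notVz) quotientY ?cycle_subG ?(subset_trans sVM) ?(subsetP nRM) //.
by rewrite abelianY !quotient_abelian ?cycle_abelian //= quotient_cents2r.
Qed.

End NonadjacencyCriterion.

(** * Induced modules of twisted functions *)

(** An embedding of the cyclic group [Y / Z] in the cyclic group of units of the
    field of order [r]. Its values are represented by natural numbers, so that
    they act on any abelian group of exponent [r]. *)
Lemma cyclic_quotient_character (gT : finGroupType) (Y Z : {group gT}) (r : nat) :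
    prime r -> Z <| Y -> cyclic (Y / Z)%g -> (#|(Y / Z)%g| %| r.-1)%N ->
  exists l : gT -> nat, {in Y &, forall y z, l (y * z)%g = l y * l z %[mod r]}
    /\ {in Y, forall y, (l y == 1 %[mod r]) = (y \in Z)}.
Proof.
move=> pr_r nsZY /cyclicP[a defYZ] n_r1; have nZY := normal_norm nsZY.
have cycU : cyclic [set: {unit 'F_r}]%g by apply: field_unit_group_cyclic.
have [u0 defU] := cyclicP cycU.
have ou0 : #[u0]%g = r.-1 by rewrite orderE -defU card_finField_unit card_Fp.
set n := #|_| in n_r1; have oa : #[a]%g = n by rewrite /n defYZ.
pose w := (u0 ^+ (r.-1 %/ n))%g.
have ow : #[w]%g = n.
  rewrite /w orderXdiv ou0 ?dvdn_div // divnA // mulKn //.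
  by rewrite -subn1 subn_gt0 prime_gt1.
have dvd_wa : (#[w]%g %| #[a]%g)%N by rewrite ow oa.
pose f := eltm dvd_wa.
pose l y : nat := val (f (coset Z y)) : 'F_r.
have lE y : (l y)%:R = val (f (coset Z y)) :> 'F_r by rewrite /l natr_Zp.
have eq_mod m1 m2 : (m1%:R == m2%:R :> 'F_r) = (m1 == m2 %[mod r]).
  by rewrite -val_eqE /= !val_Fp_nat.
have Ya y : y \in Y -> coset Z y \in <[a]>%g by move=> Yy; rewrite -defYZ mem_quotient.
exists l; split=> [y z Yy Yz | y Yy].
  apply/eqP; rewrite -eq_mod natrM !lE morphM ?(subsetP nZY) //.
  by rewrite /f morphM ?Ya.
rewrite -eq_mod lE -[1%:R]/(val (1%g : {unit 'F_r})) (inj_eq val_inj).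
have injf : 'injm f by rewrite injm_eltm ow oa.
rewrite -(morph1 (eltm_morphism dvd_wa)) (inj_in_eq (injmP injf)) ?Ya ?group1 //.
apply/eqP/idP=> [|/coset_id //]; apply: coset_idr.
exact: (subsetP nZY).
Qed.

Section Torsion.

Variables (A : zmodType) (r : nat) (a : A).
Hypothesis ar0 : a *+ r = 0.

Lemma mulrn_modn m : a *+ (m %% r) = a *+ m.
Proof. by rewrite {2}(divn_eq m r) mulrnDr mulnC mulrnA ar0 mul0rn add0r. Qed.

Lemma mulrn_coprime_eq0 m : coprime r m -> a *+ m = 0 -> a = 0.
Proof.
case: (posnP m) => [-> | m_gt0 co am0].
  by rewrite /coprime gcdn0 => /eqP r1; rewrite -ar0 r1.
have [u v Duv _] := egcdnP r m_gt0; have := congr1 (fun k => a *+ k) Duv.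
rewrite mulnC mulrnA am0 mul0rn mulrnDr mulnC mulrnA ar0 mul0rn add0r.
by rewrite gcdnC (eqP co).
Qed.

End Torsion.

Section TwistedFunctions.

Variables (gT : finGroupType) (G : {group gT}) (J : finType).
Variables (r : J -> nat) (Y Z : J -> {group gT}) (l : J -> gT -> nat).

Hypothesis pr_r : forall j, prime (r j).
Hypothesis r_inj : injective r.
Hypothesis nsYG : forall j, Y j <| G.
Hypothesis nsZG : forall j, Z j <| G.
Hypothesis sZY : forall j, Z j \subset Y j.
Hypothesis lM : forall j, {in Y j &, forall y z, l j (y * z)%g = l j y * l j z %[mod r j]}.
Hypothesis lZ : forall j, {in Y j, forall y, (l j y == 1 %[mod r j]) = (y \in Z j)}.

Let N : nat := (\prod_j r j)%N.
Local Notation A := 'I_N.-1.+1.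
Local Notation F := {ffun J * gT -> A}.

Let r_gt0 j : (0 < r j)%N. Proof. exact: prime_gt0. Qed.

Let N_gt0 : (0 < N)%N.
Proof. by rewrite prodn_gt0. Qed.

Let defN : N.-1.+1 = N. Proof. by rewrite prednK. Qed.

Let AN (a : A) : a *+ N = 0.
Proof.
by apply: val_inj; rewrite Zp_mulrn /=; apply/eqP/dvdn_mull; rewrite defN.
Qed.

Let Nj j : (N = r j * (N %/ r j))%N.
Proof. by rewrite mulnC divnK // /N (bigD1 j) //= dvdn_mulr. Qed.

(** A generator of the subgroup of order [r j]. *)
Let c j : A := inZp (N %/ r j).

Let c_neq0 j : c j != 0.
Proof.
rewrite -val_eqE /= defN modn_small; last by rewrite ltn_Pdiv ?prime_gt1.
by rewrite -lt0n divn_gt0 // (dvdn_leq N_gt0) // (Nj j) dvdn_mulr.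
Qed.

Let cr0 j : c j *+ r j = 0.
Proof.
by apply: val_inj; rewrite Zp_mulrn /c /= defN modnMml mulnC -Nj modnn.
Qed.

(** For each [j], the functions [f] on [G] with [f (y * g) = l y * f g] for all
    [y] in [Y j] form, under right translation, the module over the field of
    order [r j] that is induced from the one-dimensional module of [Y j] given
    by [l j]. The field is encoded as the subgroup of order [r j] of the cyclic
    group [A], so that the direct sum of these modules over [j] is a group of
    functions with values in [A]; outside [G] they are extended by 0. *)
Definition twisted (f : F) : bool :=
  [forall j, forall g, [&& f (j, g) *+ r j == 0, (g \notin G) ==> (f (j, g) == 0) &
     [forall y in Y j, f (j, y * g)%g == f (j, g) *+ l j y]]].

Let twistedP (f : F) : reflect (forall j g, [/\ f (j, g) *+ r j = 0,
     g \notin G -> f (j, g) = 0 & forall y, y \in Y j -> f (j, y * g)%g = f (j, g) *+ l j y])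
  (twisted f).
Proof.
apply: (iffP forallP) => [tw j g | tw j].
  have /forallP/(_ g)/and3P[/eqP t1 /implyP t2 /forall_inP t3] := tw j.
  by split=> // [/t2/eqP | y /t3/eqP].
apply/forallP=> g; have [t1 t2 t3] := tw j g; rewrite t1 eqxx /=.
apply/andP; split; first by apply/implyP=> /t2->.
by apply/forall_inP=> y /t3->.
Qed.

Let X := (gT * option (J * A))%type.

(** The semidirect product of the twisted functions by [G] is found inside the
    permutations of [X]: a function moves [a] in [(g, Some (j, a))], and an
    element of [G] multiplies [g]. The points [(g, None)] are fixed by the
    functions, and moved by the elements of [G] even if [J] is empty. *)
Let trans_fun (f : F) (x : X) : X :=
  (x.1, if x.2 is Some ja then Some (ja.1, ja.2 + f (ja.1, x.1)) else None).

Let trans_inj f : injective (trans_fun f).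
Proof.
apply: (can_inj (g := trans_fun (- f))) => -[g [[j a]|]] //.
by rewrite /trans_fun /= ffunE addrK.
Qed.

Definition translation (f : F) : {perm X} := perm (@trans_inj f).

Let shift_fun (h : gT) (x : X) : X := ((x.1 * h)%g, x.2).

Let shift_inj h : injective (shift_fun h).
Proof. by move=> [g o] [k p] [/mulIg-> ->]. Qed.

Definition right_mul (h : gT) : {perm X} := perm (@shift_inj h).

Lemma right_mulM : {morph right_mul : g h / (g * h)%g}.
Proof. by move=> g h; apply/permP=> x; rewrite permM !permE /shift_fun /= mulgA. Qed.

Canonical right_mul_morphism := @Morphism _ _ G right_mul (in2W right_mulM).

Lemma translationD : {morph translation : f g / f + g >-> (f * g)%g}.
Proof.
move=> f g; apply/permP=> -[h [[j a]|]]; rewrite permM !permE //.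
by rewrite /trans_fun /= ffunE addrA.
Qed.

Let trans_val f j g a : translation f (g, Some (j, a)) = (g, Some (j, a + f (j, g))).
Proof. by rewrite permE. Qed.

Lemma translation_inj : injective translation.
Proof.
move=> f g /permP eq_fg; apply/ffunP=> -[j h].
by have := eq_fg (h, Some (j, 0)); rewrite !trans_val !add0r => -[].
Qed.

Lemma translation0 : translation 0 = 1%g.
Proof. by apply: (mulgI (translation 0)); rewrite -translationD addr0 mulg1. Qed.

Lemma translationX f n : translation (f *+ n) = (translation f ^+ n)%g.
Proof. by elim: n => [|n IHn]; rewrite ?translation0 // mulrS translationD IHn expgS. Qed.

Let translate (f : F) (h : gT) : F := [ffun jg => f (jg.1, jg.2 * h^-1)%g].

Let translationJ f h : (translation f ^ right_mul h)%g = translation (translate f h).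
Proof.
apply: (mulgI (right_mul h)); rewrite -conjgC; apply/permP=> -[g [[j a]|]]; rewrite !permM !permE //.
by rewrite /trans_fun /shift_fun /= ffunE /= mulgK.
Qed.

Let twisted_translate f h : h \in G -> twisted f -> twisted (translate f h).
Proof.
move=> Gh /twistedP tw; apply/twistedP=> j g; rewrite !ffunE /=.
have [t1 t2 t3] := tw j (g * h^-1)%g; split=> // [notGg | y Yy].
  by rewrite t2 // groupMr ?groupV.
by rewrite ffunE /= -mulgA t3.
Qed.

Definition twisted_set : {set {perm X}} := translation @: [set f | twisted f].

Let twisted_setP v : reflect (exists2 f, twisted f & v = translation f) (v \in twisted_set).
Proof.
by apply: (iffP imsetP) => -[f]; rewrite ?inE => tw ->; exists f; rewrite ?inE.
Qed.

Lemma twisted_group_set : group_set twisted_set.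
Proof.
apply/group_setP; split=> [|_ _ /twisted_setP[f /twistedP twf ->] /twisted_setP[g /twistedP twg ->]].
  apply/twisted_setP; exists 0; rewrite ?translation0 //; apply/twistedP=> j g.
  by split=> [||y _]; rewrite ?ffunE ?mul0rn.
apply/twisted_setP; exists (f + g); last by rewrite translationD.
apply/twistedP=> j h; have [f1 f2 f3] := twf j h; have [g1 g2 g3] := twg j h.
rewrite !ffunE; split=> [|notGh|y Yy]; first by rewrite mulrnDl f1 g1 addr0.
  by rewrite f2 // g2 // addr0.
by rewrite !ffunE mulrnDl f3 // g3.
Qed.

Definition twisted_group : {group {perm X}} := Group twisted_group_set.


Let memP v : reflect (exists2 f, twisted f & v = translation f) (v \in twisted_group).
Proof. exact: twisted_setP. Qed.

Lemma twisted_group_norm : (right_mul @* G \subset 'N(twisted_group))%g.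
Proof.
apply/subsetP=> _ /morphimP[h _ Gh ->]; rewrite inE; apply/subsetP=> _ /imsetP[_ /memP[f tw ->] ->].
by rewrite translationJ; apply/memP; exists (translate f h); rewrite ?twisted_translate.
Qed.

Lemma injm_right_mul : ('injm right_mul)%g.
Proof.
apply/injmP=> g h _ _ /permP/(_ (1%g, None)).
by rewrite !permE /shift_fun /= !mul1g => -[].
Qed.

Lemma twisted_group_TI : (twisted_group :&: right_mul @* G = 1)%g.
Proof.
apply/trivgP/subsetP=> v /setIP[/memP[f _ ->] /morphimP[h _ _ Dfh]].
have /permP/(_ (1%g, None)) := Dfh; rewrite !permE /trans_fun /shift_fun /= mul1g => -[h1].
by rewrite Dfh -h1 (morph1 right_mul_morphism) inE.
Qed.

Lemma twisted_group_abelian : abelian twisted_group.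
Proof.
apply/centsP=> _ /memP[f _ ->] _ /memP[g _ ->].
by red; rewrite -!translationD addrC.
Qed.

Lemma twisted_group_exponent v : v \in twisted_group -> (v ^+ N = 1)%g.
Proof.
case/memP=> f _ ->; rewrite -translationX -translation0; congr translation.
by apply/ffunP=> jg; rewrite ffunMnE ffunE AN.
Qed.

Let commuteP f x : x \in G -> commute (translation f) (right_mul x) <->
  (forall j g, f (j, g * x^-1)%g = f (j, g)).
Proof.
move=> Gx; split=> [cfx j g | fix_f].
  have: (translation f ^ right_mul x)%g = translation f by rewrite conjgE cfx mulKg.
  by rewrite translationJ => /translation_inj/ffunP/(_ (j, g)); rewrite ffunE.
apply/commgP/conjg_fixP; rewrite translationJ; congr translation.
by apply/ffunP=> -[j g]; rewrite ffunE fix_f.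
Qed.

Let component j f : twisted f -> (translation f ^+ r j = 1)%g ->
  forall k g, k != j -> f (k, g) = 0.
Proof.
move=> /twistedP tw; rewrite -translationX -translation0 => /translation_inj/ffunP fr0 k g neq_kj.
have [fk0 _ _] := tw k g; apply: (mulrn_coprime_eq0 fk0 (m := r j)).
  by rewrite prime_coprime // dvdn_prime2 // (inj_eq r_inj).
by have := fr0 (k, g); rewrite ffunMnE ffunE.
Qed.

(** If [f] is fixed by [x], then [f g = f (g * x) = f (y * g) = l y * f g] for the
    conjugate [y = x ^ g^-1], which is in [Y j] but not in [Z j], so that
    [l y != 1]. *)
Lemma twisted_fixed_trivial j x v :
    x \in Y j -> x \notin Z j -> v \in twisted_group -> (v ^+ r j = 1)%g ->
  commute v (right_mul x) -> v = 1%g.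
Proof.
move=> Yx notZx /memP[f tw ->] fr1; have [sYG nYG] := andP (nsYG j).
have Gx := subsetP sYG x Yx.
move/(commuteP f Gx) => fix_f; rewrite -translation0; congr translation.
apply/ffunP=> -[k g]; rewrite [RHS]ffunE.
have [-> {k} | /(component tw fr1)//] := eqVneq k j.
have [t1 t2 t3] := twistedP f tw j g.
have [Gg | /t2//] := boolP (g \in G).
set y := (x ^ g^-1)%g; have Yy : y \in Y j.
  by rewrite memJ_norm // groupV (subsetP nYG).
have notZy : y \notin Z j.
  by rewrite memJ_norm // groupV (subsetP (normal_norm (nsZG j))).
have fy : f (j, g) *+ l j y = f (j, g).
  have Dyg : (y * g = g * x)%g by rewrite /y conjgE invgK -!mulgA mulVg mulg1.
  by rewrite -t3 // Dyg -(fix_f j (g * x)%g) mulgK.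
(* Modulo [r j], this multiplier is [l j y - 1]. *)
apply: (mulrn_coprime_eq0 t1 (m := (l j y + (r j).-1)%N)).
  rewrite prime_coprime //; apply: contra notZy => r_l; rewrite -lZ //.
  by rewrite -(eqn_modDr (r j).-1) add1n prednK // modnn.
by rewrite mulrnDr fy -mulrS (prednK (r_gt0 j)).
Qed.

(** This is the computation of [twisted_fixed_trivial] with [l y = 1]. *)
Lemma twisted_kernel_commute j x v :
    x \in Z j -> v \in twisted_group -> (v ^+ r j = 1)%g -> commute v (right_mul x).
Proof.
move=> Zx /memP[f tw ->] fr1; have [sZG nZG] := andP (nsZG j).
have Gx := subsetP sZG x Zx; apply/(commuteP f Gx) => k g.
have [-> {k} | neq_kj] := eqVneq k j; last by rewrite !(component tw fr1).
have [t1 t2 t3] := twistedP f tw j g.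
have [Gg | notGg] := boolP (g \in G); last first.
  have [_ t2x _] := twistedP f tw j (g * x^-1)%g.
  by rewrite t2 ?t2x ?groupMr ?groupV.
set y := (x^-1 ^ g^-1)%g; have Zy : y \in Z j.
  by rewrite memJ_norm ?groupV // (subsetP nZG).
have Yy := subsetP (sZY j) y Zy.
have -> : (g * x^-1 = y * g)%g by rewrite /y conjgE invgK -!mulgA mulVg mulg1.
rewrite t3 // -(mulrn_modn t1); have := lZ Yy; rewrite Zy => /eqP->.
by rewrite mulrn_modn.
Qed.

Let order_translation j f : twisted f -> f != 0 -> (forall k g, k != j -> f (k, g) = 0) ->
  #[translation f]%g = r j.
Proof.
move=> /twistedP tw nz_f f0; apply: nt_prime_order => //.
  rewrite -translationX -translation0; congr translation.
  apply/ffunP=> -[k g]; rewrite ffunMnE ffunE; have [-> | /f0->] := eqVneq k j.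
    by case: (tw j g).
  by rewrite mul0rn.
by apply: contraNneq nz_f; rewrite -translation0 => /translation_inj->.
Qed.

(** If [Y j = G], a twisted function is determined by its value at 1. *)
Lemma card_twisted_torsion j : Y j = G ->
  (#|[set v in twisted_group | (v ^+ r j == 1)%g]| <= r j)%N.
Proof.
move=> defY; set S := [set v in _ | _].
pose tors : {set A} := [set inZp (val k * (N %/ r j)) | k in 'I_(r j)].
pose ev (v : {perm X}) : A := if (v (1%g, Some (j, 0))).2 is Some ja then ja.2 else 0.
have evE f : ev (translation f) = f (j, 1%g) by rewrite /ev trans_val add0r.
have inj_ev : {in S &, injective ev}.
  move=> _ _ /setIdP[/memP[f tf ->] /eqP f1] /setIdP[/memP[g tg ->] /eqP g1].
  rewrite !evE => eq_fg; congr translation; apply/ffunP=> -[k h].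
  have [-> | neq_kj] := eqVneq k j; last by rewrite (component tf f1) ?(component tg g1).
  have [Gh | notGh] := boolP (h \in G); last first.
    by have [[_ -> // _] [_ -> // _]] := (twistedP f tf j h, twistedP g tg j h).
  have [[_ _ tf1] [_ _ tg1]] := (twistedP f tf j 1%g, twistedP g tg j 1%g).
  by rewrite -[h]mulg1 tf1 ?tg1 ?defY // eq_fg.
rewrite -(card_in_imset inj_ev).
apply: leq_trans (_ : #|tors| <= r j)%N; last first.
  by rewrite -[X in (_ <= X)%N](card_ord (r j)) leq_imset_card.
apply/subset_leq_card/subsetP=> _ /imsetP[_ /setIdP[/memP[f tf ->] _] ->]; rewrite evE.
have [t1 _ _] := twistedP f tf j 1%g; set a := f _ in t1 *.
have Nr_gt0 : (0 < N %/ r j)%N by rewrite divn_gt0 // (dvdn_leq N_gt0) // (Nj j) dvdn_mulr.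
have a_dvd : (N %/ r j %| a)%N.
  have /(congr1 val) := t1; rewrite Zp_mulrn /= => /eqP; rewrite -[_ == _]/(_ %| _)%N.
  by rewrite [X in (X %| _)%N]defN {1}(Nj j) [(a * _)%N]mulnC dvdn_pmul2l.
have lt_k : (a %/ (N %/ r j) < r j)%N by rewrite ltn_divLR // -Nj -{2}defN ltn_ord.
apply/imsetP; exists (Ordinal lt_k) => //=; rewrite divnK //.
by apply: val_inj; rewrite /= modn_small.
Qed.

(** The character [l j] itself, extended by 0. *)
Let seed j : F := [ffun kg => if (kg.1 == j) && (kg.2 \in Y j) then c j *+ l j kg.2 else 0].

Let seed_twisted j : twisted (seed j).
Proof.
apply/twistedP=> k g; rewrite !ffunE /=; have [-> {k}| neq_kj] /= := eqVneq k j; last first.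
  by split=> [||y _]; rewrite ?ffunE ?mul0rn //= (negPf neq_kj).
have [sYG _] := andP (nsYG j); split=> [|notGg|y Yy].
- by case: ifP => _; rewrite ?mul0rn // -mulrnA mulnC mulrnA cr0 mul0rn.
- by rewrite (contraNF (subsetP sYG g)).
rewrite ffunE /= eqxx groupMl //=; case: ifP => Yg; last by rewrite mul0rn.
by rewrite -(mulrn_modn (cr0 j)) lM // mulrn_modn ?cr0 // mulnC mulrnA.
Qed.

Let seed1 j : seed j (j, 1%g) = c j.
Proof.
rewrite ffunE /= eqxx group1 /= -(mulrn_modn (cr0 j)).
by have := lZ (group1 (Y j)); rewrite group1 => /eqP->; rewrite mulrn_modn ?cr0.
Qed.

Let seed0 j k g : k != j -> seed j (k, g) = 0.
Proof. by rewrite ffunE /= => /negPf->. Qed.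

Let seed_mem j : translation (seed j) \in twisted_group.
Proof. by apply/memP; exists (seed j). Qed.

Let seed_order j : #[translation (seed j)]%g = r j.
Proof.
apply: order_translation; [exact: seed_twisted | | exact: seed0].
by apply: contraNneq (c_neq0 j) => s0; rewrite -seed1 s0 ffunE.
Qed.

Lemma twisted_order_exists j : exists2 v, v \in twisted_group & #[v]%g = r j.
Proof. by exists (translation (seed j)). Qed.

(** If [x] is in [Z j], all the elements of order [r j] are fixed. If it is not
    in [Y j], nor are its powers but 1; so in the sum of the translates of
    [seed j] under the powers of [x] only one term is nonzero at 1, and this sum
    is a nonzero fixed function. *)
Lemma twisted_fixed_exists j x : x \in G -> prime #[x]%g -> (x \notin Y j) || (x \in Z j) ->
  exists v, [/\ v \in twisted_group, #[v]%g = r j & commute v (right_mul x)].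
Proof.
move=> Gx pr_x YZx.
have [Zx | notZx] := boolP (x \in Z j).
  exists (translation (seed j)); split=> //; apply: (twisted_kernel_commute Zx) => //.
  by rewrite -(seed_order j) expg_order.
rewrite (negPf notZx) orbF in YZx.
pose f : F := [ffun kg => \sum_(i < #[x]%g) seed j (kg.1, kg.2 * x ^- i)%g].
have tw : twisted f.
  apply/twistedP=> k g; have tws i := twistedP _ (seed_twisted j) k (g * x ^- i)%g.
  rewrite ffunE -sumrMnl; split=> [|notGg|y Yy].
  - by rewrite big1 // => i _; case: (tws i).
  - rewrite big1 // => i _; case: (tws i) => _ -> //.
    by rewrite groupMr // groupV groupX.
  rewrite ffunE -sumrMnl; apply: eq_bigr => i _ /=; rewrite -mulgA.
  by case: (tws i) => _ _ ->.
have f0 k g : k != j -> f (k, g) = 0.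
  by move=> neq_kj; rewrite ffunE big1 // => i _; rewrite seed0.
have nz_f : f != 0.
  have f1 : f (j, 1%g) = c j.
    rewrite ffunE (bigD1 (Ordinal (order_gt0 x))) //= big1 => [|i nz_i].
      by rewrite addr0 expg0 invg1 mulg1 seed1.
    rewrite ffunE /= mul1g [_ \in _]negbTE ?andbF // groupV.
    apply: contra YZx => Yxi; rewrite -cycle_subG.
    have /eqP-> : generator <[x]>%g (x ^+ i)%g.
      rewrite generator_coprime prime_coprime // gtnNdvd // lt0n.
      by apply: contraNneq nz_i => i0; apply/eqP/val_inj.
    by rewrite cycle_subG.
  by apply: contraNneq (c_neq0 j) => f00; rewrite -f1 f00 ffunE.
exists (translation f); split; first by apply/memP; exists f.
  exact: order_translation.
apply/(commuteP f Gx) => k g; rewrite !ffunE /=.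
have step i : (g * x^-1 * x ^- i = g * x ^- i.+1)%g.
  by rewrite -mulgA -invMg -expgSr.
case: #[x]%g (expg_order x) => [_ | p xp]; first by rewrite !big_ord0.
rewrite big_ord_recr [RHS]big_ord_recl /= addrC step xp; congr (_ + _).
by apply: eq_bigr => i _; rewrite step.
Qed.

End TwistedFunctions.

(** The properties of the semidirect product [V ><| s @* G] of the twisted
    functions by [G], without the details of its construction: the elements of
    [V] with order [r j] form the module induced from a one-dimensional module
    of [Y j] with kernel [Z j]. In this form the construction is easily
    repeated, with [V <*> s @* G] for [G]. *)
Record twisted_extension (gT hT : finGroupType) (G : {group gT}) (J : finType)
    (r : J -> nat) (Y Z : J -> {group gT}) (V : {group hT})
    (s : {morphism G >-> hT}) : Prop := TwistedExtension {
  ext_inj : ('injm s)%g;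
  ext_norm : (s @* G \subset 'N(V))%g;
  ext_TI : (V :&: s @* G = 1)%g;
  ext_abelian : abelian V;
  ext_exponent : {in V, forall v, v ^+ (\prod_j r j)%N = 1}%g;
  ext_fixed_trivial : forall j x v, x \in Y j -> x \notin Z j -> v \in V ->
    (v ^+ r j = 1)%g -> commute v (s x) -> v = 1%g;
  ext_fixed_exists : forall j x, x \in G -> prime #[x]%g ->
    (x \notin Y j) || (x \in Z j) ->
    exists v, [/\ v \in V, #[v]%g = r j & commute v (s x)];
  ext_kernel_commute : forall j x v, x \in Z j -> v \in V -> (v ^+ r j = 1)%g ->
    commute v (s x);
  ext_order_exists : forall j, exists2 v, v \in V & #[v]%g = r j;
  ext_torsion : forall j, Y j = G -> (#|[set v in V | v ^+ r j == 1]%g| <= r j)%N }.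

(** The group [V] consists of the functions twisted by the characters that
    [cyclic_quotient_character] provides. *)
Lemma twisted_extension_exists (gT : finGroupType) (G : {group gT}) (J : finType)
    (r : J -> nat) (Y Z : J -> {group gT}) :
    (forall j, prime (r j)) -> injective r ->
    (forall j, Y j <| G) -> (forall j, Z j <| G) -> (forall j, Z j \subset Y j) ->
    (forall j, cyclic (Y j / Z j)%g) -> (forall j, #|(Y j / Z j)%g| %| (r j).-1)%N ->
  exists (hT : finGroupType) (V : {group hT}) (s : {morphism G >-> hT}),
    twisted_extension r Y Z V s.
Proof.
move=> pr_r r_inj nsYG nsZG sZY cycYZ dvdYZ.
have /fin_all_exists[l lP] j : exists l : gT -> nat,
    {in Y j &, forall y z, l (y * z)%g = l y * l z %[mod r j]}
    /\ {in Y j, forall y, (l y == 1 %[mod r j]) = (y \in Z j)}.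
  apply: cyclic_quotient_character => //.
  by rewrite /normal sZY (subset_trans (normal_sub (nsYG j)) (normal_norm (nsZG j))).
have lM j := (lP j).1; have lZ j := (lP j).2.
exists _, (twisted_group G r Y l), (right_mul_morphism G r); split.
- exact: injm_right_mul.
- exact: twisted_group_norm.
- exact: twisted_group_TI.
- exact: twisted_group_abelian.
- by move=> v; apply: twisted_group_exponent.
- by move=> j x v; apply: twisted_fixed_trivial.
- by move=> j x; apply: twisted_fixed_exists.
- by move=> j x v; apply: twisted_kernel_commute.
- by move=> j; apply: twisted_order_exists.
by move=> j; apply: card_twisted_torsion.
Qed.

(** * Extensions by twisted functions *)

Lemma prime_dvd_prod (T : finType) (Q : pred T) (r : T -> nat) p :
    (forall t, prime (r t)) -> prime p -> (p %| \prod_(t | Q t) r t)%N ->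
  exists2 t, Q t & p = r t.
Proof.
move=> pr_r pr_p; elim/big_ind: _ => [|m n IHm IHn|t Qt]; first by rewrite Euclid_dvd1.
  by rewrite Euclid_dvdM // => /orP[].
by rewrite dvdn_prime2 // => /eqP->; exists t.
Qed.

(** The complement [H] contains a Sylow [p]-subgroup of [V <*> H]. *)
Lemma Sylow_conj_complement (hT : finGroupType) (V H : {group hT}) p x :
    prime p -> ~~ (p %| #|V|)%N -> (H \subset 'N(V))%g -> (V :&: H = 1)%g ->
    x \in (V <*> H)%g -> #[x]%g = p ->
  exists2 g, g \in (V <*> H)%g & (x ^ g)%g \in H.
Proof.
move=> pr_p p'V nVH tiVH Gx ox; have [P sylP] := Sylow_exists p H.
have [sPH pP p'iP] := and3P sylP.
have sHG : H \subset (V <*> H)%g := joing_subr _ _.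
have sylPG : p.-Sylow(V <*> H)%g P.
  rewrite /pHall (subset_trans sPH) // pP -(Lagrange_index sHG sPH) pnatM p'iP andbT.
  rewrite -divgS //= norm_joinEr // TI_cardMg // mulnK ?cardG_gt0 //.
  by rewrite p'natE.
have [||g Gg sxP] := Sylow_Jsub sylPG (_ : <[x]>%g \subset _) _.
- by rewrite cycle_subG.
- by rewrite /pgroup -orderE ox pnat_id.
by exists g; rewrite // (subsetP sPH) // (subsetP sxP) // memJ_conjg cycle_id.
Qed.

Section SplitExtension.

Local Open Scope group_scope.

Variables (gT hT : finGroupType) (G : {group gT}) (J : finType).
Variables (r : J -> nat) (Y Z : J -> {group gT}).
Variables (V : {group hT}) (s : {morphism G >-> hT}).
Hypothesis pr_r : forall j, prime (r j).
Hypothesis r_inj : injective r.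
Hypothesis ext : twisted_extension r Y Z V s.

Let inj_s := ext_inj ext.
Let nVs := ext_norm ext.
Let tiVs := ext_TI ext.
Let abV := ext_abelian ext.
Let expV := ext_exponent ext.

Local Notation E := (V <*> s @* G)%G.

Lemma split_extension_normal : V <| E.
Proof. by rewrite /normal joing_subl join_subG normG nVs. Qed.

Lemma card_split_extension : (#|E| = #|V| * #|G|)%N.
Proof. by rewrite /= norm_joinEr // TI_cardMg // card_injm. Qed.

Lemma split_extension_sol : solvable G -> solvable E.
Proof.
move=> solG; rewrite (series_sol split_extension_normal) abelian_sol //=.
by rewrite quotientYidl // quotient_sol ?morphim_sol.
Qed.

Lemma split_extension_order_conj p x : prime p -> ~~ (p %| #|V|)%N ->
    x \in E -> #[x] = p ->
  exists2 g, g \in E & exists y, [/\ y \in G, #[y] = p & x ^ g = s y].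
Proof.
move=> pr_p p'V Ex ox.
have [g Eg /morphimP[y _ Gy Dxg]] := Sylow_conj_complement pr_p p'V nVs tiVs Ex ox.
by exists g => //; exists y; split=> //; rewrite -(order_injm inj_s) // -Dxg orderJ.
Qed.

Lemma prime_dvd_split_kernel p : prime p -> (p %| #|V|)%N -> exists j, p = r j.
Proof.
move=> pr_p p_V; have [v Vv ov] := Cauchy pr_p p_V.
have: (p %| \prod_j r j)%N by rewrite -ov order_dvdn expV.
by case/(prime_dvd_prod pr_r pr_p) => j; exists j.
Qed.

Lemma split_kernel_core_exp j v : v \in 'O_(r j)(V) -> v ^+ r j = 1.
Proof.
move=> Ov; have Vv := subsetP (pcore_sub _ _) v Ov.
have r_v := mem_p_elt (pcore_pgroup _ _) Ov.
apply/eqP; rewrite -order_dvdn; have: (#[v] %| \prod_j r j)%N by rewrite order_dvdn expV.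
rewrite (bigD1 j) //= Gauss_dvdl // (pnat_coprime r_v) //.
elim/big_ind: _ => // [m n r'm r'n | k neq_kj]; first by rewrite pnatM r'm.
by rewrite pnatE // !inE (inj_eq r_inj).
Qed.

Lemma split_kernel_core_Sylow j : (r j).-Sylow(V) 'O_(r j)(V).
Proof. by rewrite nilpotent_pcore_Hall ?abelian_nil. Qed.

Lemma split_kernel_core_regular j x :
  x \in Y j -> x \notin Z j -> 'C_('O_(r j)(V))[s x] = 1.
Proof.
move=> Yx notZx; apply/trivgP/subsetP=> v /setIP[Ov /cent1P cvx].
apply/set1P/(ext_fixed_trivial ext Yx notZx) => //.
- exact: subsetP (pcore_sub _ _) v Ov.
- exact: split_kernel_core_exp.
Qed.

Lemma split_kernel_core_prime j : Y j = G -> (#|'O_(r j)(V)| <= r j)%N.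
Proof.
move=> defY; apply: leq_trans (ext_torsion ext defY).
apply/subset_leq_card/subsetP=> v Ov; rewrite inE split_kernel_core_exp // eqxx andbT.
exact: subsetP (pcore_sub _ _) v Ov.
Qed.

Lemma prime_dvd_split_extension p : prime p -> (p %| #|E|)%N ->
  (exists j, p = r j) \/ (p %| #|G|)%N.
Proof.
move=> pr_p; rewrite card_split_extension Euclid_dvdM // => /orP[/prime_dvd_split_kernel|]; last by right.
by move=> dV; left; apply: dV.
Qed.

Lemma split_extension_sub_normal (A : {group gT}) : A <| G -> V <*> s @* A <| E.
Proof.
move=> nsAG; have sAG := morphimS s (normal_sub nsAG).
rewrite /normal join_subG joing_subl (subset_trans sAG) ?joing_subr //= join_subG.
rewrite (subset_trans (joing_subl _ _) (normG _)) normsY //.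
by rewrite normal_norm // morphim_normal.
Qed.

Lemma card_split_extension_sub (A : {group gT}) : A \subset G ->
  (#|V <*> s @* A| = #|V| * #|A|)%N.
Proof.
move=> sAG; have sA := morphimS s sAG.
rewrite norm_joinEr ?(subset_trans sA) // TI_cardMg ?card_injm //.
by apply/trivgP; rewrite -tiVs setIS.
Qed.

(** An element of order [p] is conjugate to an element of [s @* G]. *)
Lemma split_extension_regular j p : prime p -> ~~ (p %| #|V|)%N ->
    (forall x, x \in G -> #[x] = p -> (x \in Y j) && (x \notin Z j)) ->
  {in E, forall x, #[x] = p -> 'C_('O_(r j)(V))[x] = 1}.
Proof.
move=> pr_p p'V YZ x Ex ox.
have nsQE : 'O_(r j)(V) <| E by apply: gFnormal_trans split_extension_normal.
have [g Eg [y [Gy oy Dxg]]] := split_extension_order_conj pr_p p'V Ex ox.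
have [Yy notZy] := andP (YZ y Gy oy).
apply/trivgP; rewrite -(conjSg _ _ g) conjIg -cent1J Dxg (normsP (normal_norm nsQE)) //.
by rewrite split_kernel_core_regular ?sub1set ?group1 // sub1G.
Qed.

(** The Sylow [r j]-subgroup of [V] is an abelian normal Sylow subgroup of [E], on
    which the elements of order [p] act without fixed points. *)
Lemma split_extension_nonadjacent j p (i : Iirr E) :
    prime p -> ~~ (p %| #|V|)%N -> ~~ (r j %| #|G|)%N ->
    (forall x, x \in G -> #[x] = p -> (x \in Y j) && (x \notin Z j)) ->
  ~~ ((p %| codegree 'chi_i)%C && (r j %| codegree 'chi_i)%C).
Proof.
move=> pr_p p'V r'G YZ; have [sVE nVE] := andP split_extension_normal.
pose Q := 'O_(r j)(V)%G; have nsQE : Q <| E.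
  by apply: gFnormal_trans split_extension_normal.
apply: (@normal_abelian_Sylow_codegree _ _ i Q p (r j)) => //.
- exact: abelianS (pcore_sub _ _) abV.
- rewrite -(Lagrange_index sVE (pcore_sub _ _)) Euclid_dvdM // negb_or.
  rewrite -divgS // card_split_extension mulKn ?cardG_gt0 // r'G /= -p'natE //.
  by case/and3P: (split_kernel_core_Sylow j).
exact: split_extension_regular.
Qed.

(** An element [y] of order [p] acts on [Q] without fixed points, so that
    [[~: Q, <[y]>] = Q]; lifted to [M = V <*> s @* Q], this is the condition on
    the section [M / V] in [prime_section_codegree]. *)
Lemma split_extension_section_nonadjacent (Q : {group gT}) p q (i : Iirr E) :
    prime p -> prime q -> ~~ (p %| #|V|)%N -> ~~ (q %| #|V|)%N ->
    Q <| G -> #|Q| = q -> ~~ (q %| #|G : Q|)%N ->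
    {in G, forall y, #[y] = p -> 'C_Q[y] = 1} ->
  ~~ ((p %| codegree 'chi_i)%C && (q %| codegree 'chi_i)%C).
Proof.
move=> pr_p pr_q p'V q'V nsQG oQ q'iQ regQ; have nsVE := split_extension_normal.
have [sQG nQG] := andP nsQG; pose M := (V <*> s @* Q)%G.
have nsME : M <| E := split_extension_sub_normal nsQG.
have sVM : V \subset M := joing_subl _ _.
have nVQ : s @* Q \subset 'N(V) := subset_trans (morphimS s sQG) nVs.
apply: (@prime_section_codegree _ _ i M V p q) => //.
- by rewrite -divgS // card_split_extension_sub // mulKn ?cardG_gt0.
- rewrite -divgS ?normal_sub // card_split_extension card_split_extension_sub //.
  by rewrite divnMl ?cardG_gt0 // divgS.
move=> x Ex ox; have [g Eg [y [Gy oy Dxg]]] := split_extension_order_conj pr_p p'V Ex ox.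
have nME := normal_norm nsME; have nVE := normal_norm nsVE.
rewrite -(conjSg _ _ g) conjsMg conjsRg !(normsP nME, normsP nVE) // -cycleJ Dxg.
have defM : M :=: s @* Q * V by rewrite /= norm_joinEr // -(normC nVQ).
rewrite {1}defM mulSg // -{1}(commg_regular (subsetP nQG y Gy) (regQ y Gy oy)).
by rewrite morphimR ?cycle_subG // morphim_cycle // commSg // joing_subr.
Qed.

End SplitExtension.

Lemma mem_normal_coprime_index (gT : finGroupType) (G N : {group gT}) x :
  N <| G -> x \in G -> coprime #[x]%g #|G : N| -> x \in N.
Proof.
move=> nsNG Gx co; have Nx := subsetP (normal_norm nsNG) x Gx.
apply: coset_idr => //; apply/eqP; rewrite -order_eq1 -dvdn1 -(eqP co) dvdn_gcd.
by rewrite morph_order // -card_quotient ?normal_norm // order_dvdG // mem_quotient.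
Qed.

(** * The solvable group of a coloured graph *)

Lemma squarefree_dvdn n m : (0 < n)%N -> (forall p, logn p n <= 1)%N ->
  (forall p, prime p -> p %| n -> p %| m)%N -> (n %| m)%N.
Proof.
move=> n_gt0 sqf_n dvd_m; apply/dvdn_partP=> // p; rewrite mem_primes => /and3P[pr_p _ p_n].
rewrite p_part; apply: dvdn_trans (dvd_m p pr_p p_n).
by rewrite -[X in (_ %| X)%N]expn1 dvdn_exp2l.
Qed.

Lemma squarefree_abelian_cyclic (gT : finGroupType) (A : {group gT}) :
  abelian A -> (forall p, logn p #|A| <= 1)%N -> cyclic A.
Proof.
move=> abA sqf; apply: nil_Zgroup_cyclic (abelian_nil abA).
apply/forall_inP=> P /SylowP[p pr_p sylP].
have := card_Hall sylP; rewrite p_part.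
case: (logn p #|A|) (sqf p) => [|[|//]] _ oP; last by rewrite prime_cyclic ?oP ?expn1.
by rewrite (card1_trivg oP) cyclic1.
Qed.

Lemma mem_pcore_abelian (gT : finGroupType) (A : {group gT}) (pi : nat_pred) x p :
    abelian A -> x \in A -> #[x]%g = p -> prime p ->
  (x \in 'O_pi(A))%g = (p \in pi).
Proof.
move=> abA Ax ox pr_p.
have hallO : pi.-Hall(A) 'O_pi(A) by rewrite nilpotent_pcore_Hall ?abelian_nil.
by rewrite (mem_normal_Hall hallO) ?pcore_normal // /p_elt ox pnatE.
Qed.

Lemma logn_prod_primes (T : finType) (Q : pred T) (r : T -> nat) p :
    (forall t, prime (r t)) -> injective r ->
  (logn p (\prod_(t | Q t) r t) <= 1)%N.
Proof.
move=> pr_r r_inj.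
have logn0 (Q' : pred T) : (forall t, Q' t -> r t != p) -> logn p (\prod_(t | Q' t) r t) = 0%N.
  move=> neq; suffices [] : (0 < \prod_(t | Q' t) r t)%N /\ logn p (\prod_(t | Q' t) r t) = 0%N by [].
  elim/big_ind: _ => [|m n [m0 lm] [n0 ln]|t Qt].
  - by rewrite logn1.
  - by rewrite muln_gt0 m0 n0 lognM // lm ln.
  by rewrite prime_gt0 // logn_prime // eq_sym (negPf (neq t Qt)).
have [t /andP[Qt /eqP rt] | no_t] := pickP (fun t => Q t && (r t == p)).
  have rest_gt0 : (0 < \prod_(u | Q u && (u != t)) r u)%N.
    by rewrite prodn_cond_gt0 // => u _; apply: prime_gt0.
  rewrite (bigD1 t) //= (lognM _ (prime_gt0 (pr_r t)) rest_gt0).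
  rewrite logn0 ?addn0 => [|u /andP[_ neq_ut]]; last by rewrite -rt (inj_eq r_inj).
  by rewrite logn_prime // leq_b1.
by rewrite logn0 // => t Qt; have := no_t t; rewrite Qt => /negbT.
Qed.

Section Construction.

Local Open Scope group_scope.

Variables (T : finType) (e : rel T) (col r : T -> nat).
Hypothesis e_sym : symmetric e.
Hypothesis proper : forall t u, complement e t u -> col t != col u.
Hypothesis col_lt3 : forall t, (col t < 3)%N.
Hypothesis tri : triangle_free (complement e).
Hypothesis pr_r : forall t, prime (r t).
Hypothesis r_inj : injective r.
Hypothesis r_mod : forall t u, (col t < col u)%N -> (r t %| (r u).-1)%N.

Definition base_order : nat := \prod_(t | col t == 0) r t.

Let base_order_gt0 : (0 < base_order)%N.
Proof. by rewrite prodn_cond_gt0 // => t _; apply: prime_gt0. Qed.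

Definition base_group : {group 'I_base_order.-1.+1} := [set: 'I_base_order.-1.+1]%G.
Local Notation C := base_group.

Let card_C : #|C| = base_order.
Proof. by rewrite cardsT card_ord prednK. Qed.

Let cyclic_C : cyclic C.
Proof. by apply/cyclicP; exists Zp1; rewrite -Zp_cycle. Qed.

Let abelian_C : abelian C. Proof. exact: cyclic_abelian. Qed.

Let dvd_C p : prime p -> (p %| #|C|)%N = [exists t, (col t == 0%N) && (p == r t)].
Proof.
move=> pr_p; rewrite card_C; apply/idP/existsP=> [/prime_dvd_prod[] // t t0 -> | [t /andP[t0 /eqP->]]].
  by exists t; rewrite t0 eqxx.
by rewrite /base_order (bigD1 t) //= dvdn_mulr.
Qed.

Let sqf_C p : (logn p #|C| <= 1)%N.
Proof. by rewrite card_C logn_prod_primes. Qed.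

Definition colour_class (k : nat) := {t : T | col t == k}.

Definition class_prime k (j : colour_class k) : nat := r (val j).

Definition class_primes (k : nat) (Q : pred T) : nat_pred :=
  [pred p | [exists t, [&& col t == k, Q t & p == r t]]].

Let mem_class_primes k (Q : pred T) t : col t = k -> (r t \in class_primes k Q) = Q t.
Proof.
move=> ct; apply/existsP/idP=> [[u /and3P[_ Qu /eqP/r_inj->]] // | Qt].
by exists t; rewrite ct Qt !eqxx.
Qed.

Let class_prime_pr k (j : colour_class k) : prime (class_prime j).
Proof. exact: pr_r. Qed.

Let class_prime_inj k : injective (@class_prime k).
Proof. by move=> i j /r_inj/val_inj. Qed.

Let class_prime_ndvd k (j : colour_class k) n :
  (forall p, prime p -> (p %| n)%N -> exists2 t, (col t < k)%N & p = r t) ->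
  ~~ (class_prime j %| n)%N.
Proof.
move=> dvd_n; apply/negP=> /(dvd_n _ (pr_r _))[t lt_t /r_inj Dt].
by rewrite -Dt (eqP (valP j)) ltnn in lt_t.
Qed.

Let dvd_pred_class k (j : colour_class k) n : (0 < n)%N -> (forall p, logn p n <= 1)%N ->
    (forall p, prime p -> (p %| n)%N -> exists2 t, (col t < k)%N & p = r t) ->
  (n %| (class_prime j).-1)%N.
Proof.
move=> n_gt0 sqf dvd_n; apply: squarefree_dvdn => // p pr_p /(dvd_n p pr_p)[t lt_t ->].
by apply: r_mod; rewrite (eqP (valP j)).
Qed.

Let prime_dvd_C p : prime p -> (p %| #|C|)%N -> exists2 t, (col t < 1)%N & p = r t.
Proof. by move=> pr_p; rewrite dvd_C // => /existsP[t /andP[t0 /eqP->]]; exists t; rewrite // (eqP t0). Qed.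

Let sqf_dvd n m : (0 < m)%N -> (n %| m)%N -> (forall p, logn p m <= 1)%N -> forall p, (logn p n <= 1)%N.
Proof. by move=> m_gt0 n_m sqf p; apply: leq_trans (sqf p); apply: dvdn_leq_log. Qed.

(** The first layer is a sum of one-dimensional modules of [C], one for each
    vertex [d] of colour 1. The subgroup of order [r o] acts trivially on it if
    and only if [o] is a neighbour of [d]. *)
Definition ext1_dom (d : colour_class 1) : {group 'I_base_order.-1.+1} := C.
Definition ext1_ker (d : colour_class 1) : {group 'I_base_order.-1.+1} :=
  'O_(class_primes 0 (e (val d)))(C)%G.

Lemma ext1_exists : exists (hT : finGroupType) (V : {group hT}) (s : {morphism C >-> hT}),
  twisted_extension (@class_prime 1) ext1_dom ext1_ker V s.
Proof.
apply: twisted_extension_exists => [d||d|d|d|d|d].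
- exact: class_prime_pr.
- exact: class_prime_inj.
- exact: normal_refl.
- exact: pcore_normal.
- exact: pcore_sub.
- exact: quotient_cyclic.
apply: dvd_pred_class => //.
  by apply: sqf_dvd sqf_C; rewrite ?cardG_gt0 ?dvdn_quotient.
by move=> p pr_p p_C; apply: prime_dvd_C => //; apply: dvdn_trans p_C (dvdn_quotient _ _).
Qed.

Section SecondStage.

Variables (hT1 : finGroupType) (V1 : {group hT1}) (s1 : {morphism C >-> hT1}).
Hypothesis ext1 : twisted_extension (@class_prime 1) ext1_dom ext1_ker V1 s1.

Local Notation K := (V1 <*> s1 @* C)%G.

Let abV1 := ext_abelian ext1.
Let nsV1K : V1 <| K := split_extension_normal ext1.
Let card_K : (#|K| = #|V1| * #|C|)%N := card_split_extension ext1.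

Let prime_dvd_V1 p : prime p -> (p %| #|V1|)%N -> exists2 t, col t = 1%N & p = r t.
Proof.
move=> pr_p /(prime_dvd_split_kernel (@class_prime_pr 1) ext1 pr_p)[d ->].
by exists (val d) => //; apply/eqP/(valP d).
Qed.

Let prime_dvd_K p : prime p -> (p %| #|K|)%N -> exists2 t, (col t < 2)%N & p = r t.
Proof.
move=> pr_p; rewrite card_K Euclid_dvdM // => /orP[/prime_dvd_V1|/prime_dvd_C] [] // t ct ->.
  by exists t; rewrite // ct.
by exists t; rewrite // (ltn_trans ct).
Qed.

Let sqf_K p : (logn p #|K| <= 1)%N.
Proof.
rewrite card_K lognM ?cardG_gt0 //.
have [pr_p | npr_p] := boolP (prime p); last by rewrite /logn (negPf npr_p).
have [p_V1 | p'V1] := boolP (p %| #|V1|)%N; last first.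
  by rewrite logn_coprime ?prime_coprime // sqf_C.
have [d cd Dp] := prime_dvd_V1 pr_p p_V1.
rewrite [X in (_ + X)%N]logn_coprime ?addn0; last first.
  rewrite prime_coprime //; apply/negP=> /(prime_dvd_C pr_p)[t ct]; rewrite Dp => /r_inj Dt.
  by rewrite -Dt cd in ct.
have cd' : col d == 1%N by rewrite cd.
pose j : colour_class 1 := exist _ d cd'.
have := split_kernel_core_prime (@class_prime_pr 1) (@class_prime_inj 1) ext1 (erefl (ext1_dom j)).
rewrite (card_Hall (split_kernel_core_Sylow ext1 j)) p_part /class_prime /= -Dp.
by rewrite -[X in (_ <= X)%N]expn1 leq_exp2l ?prime_gt1.
Qed.

(** For a vertex [i] of colour 2, the module is induced from a one-dimensional
    module of the subgroup generated by [V1] and by the part of [C] that belongs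
    to the vertices not adjacent to [i]; the kernel is the part of [V1] that
    belongs to the neighbours of [i]. So the elements of order [r t] act without
    fixed points if and only if [t] and [i] are not adjacent, for [t] of colour
    0 as for [t] of colour 1. *)
Definition ext2_base (i : colour_class 2) : {group hT1} :=
  (s1 @* 'O_(class_primes 0 (fun t => ~~ e t (val i)))(C))%G.
Definition ext2_dom (i : colour_class 2) : {group hT1} := (V1 <*> ext2_base i)%G.
Definition ext2_ker (i : colour_class 2) : {group hT1} :=
  'O_(class_primes 1 (e (val i)))(V1)%G.

Let ext2_ker_normal i : ext2_ker i <| K.
Proof. exact: gFnormal_trans nsV1K. Qed.

Let ext2_dom_normal i : ext2_dom i <| K.
Proof. by apply: (split_extension_sub_normal ext1); apply: pcore_normal. Qed.

(** The orders of [b] and [u] involve only vertices [o] of colour 0 and [d] of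
    colour 1 that are not adjacent to [i]. As the complement of the graph has no
    triangle, such [o] and [d] are adjacent, so that the [o]-part of [C] acts
    trivially on the [d]-part of [V1]. *)
Let ext2_base_commute i b u : b \in ext2_base i -> u \in V1 ->
  (class_primes 1 (e (val i)))^'.-elt u -> commute u b.
Proof.
case/morphimP=> y Cy Oy -> Vu pi'u; set pi := class_primes 1 _ in pi'u.
pose W := 'C_V1[s1 y]%G; have sWV : W \subset V1 := subsetIl _ _.
have nWV : V1 \subset 'N(W) := sub_abelian_norm abV1 sWV.
have piVW : pi.-group (V1 / W).
  apply/pgroupP=> p pr_p; rewrite card_quotient // => p_iW.
  have [d cd Dp] := prime_dvd_V1 pr_p (dvdn_trans p_iW (dvdn_indexg _ _)).
  rewrite Dp mem_class_primes //; apply: contraLR p_iW => not_e.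
  have cd' : col d == 1%N by rewrite cd.
  pose j : colour_class 1 := exist _ d cd'.
  have Kj : y \in ext1_ker j.
    apply: subsetP Oy; apply: sub_pcore => q /existsP[o /and3P[co not_eo /eqP->]].
    rewrite mem_class_primes /= ?(eqP co) //; apply: contraR (not_e) => not_ed.
    have neq_col t1 t2 : col t1 != col t2 -> t1 != t2 by apply: contraNneq => ->.
    have /negP[] := tri o d (val i); rewrite /complement /= not_eo.
    rewrite [e o d]e_sym not_ed [e d _]e_sym not_e !andbT.
    by rewrite !neq_col // ?cd ?(eqP co) ?(eqP (valP i)).
  have sOW : 'O_(class_prime j)(V1) \subset W.
    apply/subsetP=> v Ov; have Vv := subsetP (pcore_sub _ _) v Ov.
    rewrite inE Vv; apply/cent1P.
    apply: (ext_kernel_commute ext1 Kj Vv).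
    exact: (split_kernel_core_exp (@class_prime_pr 1) (@class_prime_inj 1) ext1).
  rewrite -p'natE //; apply: pnat_dvd (indexgS _ sOW) _.
  by have /and3P[_ _] := split_kernel_core_Sylow ext1 j; rewrite /class_prime /= -Dp.
have Wu : u \in W.
  apply: coset_idr; first exact: subsetP nWV u Vu.
  apply/eqP; rewrite -order_eq1; apply/eqP.
  apply: (pnat_1 (pi := pi)); first by apply: mem_p_elt piVW _; apply: mem_quotient.
  exact: morph_p_elt (subsetP nWV u Vu) pi'u.
by have /setIP[_ /cent1P] := Wu.
Qed.

(** This makes [ext2_dom i / ext2_ker i] abelian, hence cyclic, as its order is
    squarefree. *)
Let ext2_centralise i : [~: V1, ext2_base i] \subset ext2_ker i.
Proof.
rewrite gen_subG; apply/subsetP=> _ /imset2P[v b Vv Bb ->].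
set pi := class_primes 1 (e (val i)); pose w := v.`_pi; pose u := v.`_pi^'.
have [Vw Vu] : w \in V1 /\ u \in V1 by split; apply: groupX.
have hallZ : pi.-Hall(V1) (ext2_ker i) by rewrite nilpotent_pcore_Hall ?abelian_nil.
have Zw : w \in ext2_ker i by rewrite (mem_normal_Hall hallZ) ?pcore_normal ?p_elt_constt.
have cub : commute u b by apply: ext2_base_commute Bb Vu _; apply: p_elt_constt.
have Kb : b \in K.
  have sBC : ext2_base i \subset s1 @* C by rewrite morphimS ?pcore_sub.
  exact: subsetP (subset_trans sBC (joing_subr _ _)) b Bb.
have nZK := normal_norm (ext2_ker_normal i).
have -> : [~ v, b] = (w^-1 * w ^ b) ^ u.
  rewrite commgEl -{1 2}(consttC pi v) -/w -/u conjMg invMg.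
  by rewrite [u ^ b]conjgE cub mulKg [RHS]conjgE !mulgA.
rewrite memJ_norm; last by rewrite (subsetP nZK) // (subsetP (joing_subl _ _)).
by rewrite groupM ?groupV // memJ_norm // (subsetP nZK).
Qed.

Lemma ext2_exists : exists (hT : finGroupType) (V : {group hT}) (s : {morphism K >-> hT}),
  twisted_extension (@class_prime 2) ext2_dom ext2_ker V s.
Proof.
have sZY i : ext2_ker i \subset ext2_dom i.
  by rewrite (subset_trans (pcore_sub _ _)) ?joing_subl.
have dvdYZ i : (#|ext2_dom i / ext2_ker i| %| #|K|)%N.
  apply: dvdn_trans (dvdn_quotient _ _) _; apply: cardSg; exact: normal_sub.
apply: twisted_extension_exists => [i||i|i|i|i|i].
- exact: class_prime_pr.
- exact: class_prime_inj.
- exact: ext2_dom_normal.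
- exact: ext2_ker_normal.
- exact: sZY.
- apply: squarefree_abelian_cyclic; last first.
    exact: sqf_dvd (cardG_gt0 _) (dvdYZ i) sqf_K.
  have sBC : ext2_base i \subset s1 @* C by rewrite morphimS ?pcore_sub.
  have nZK := normal_norm (ext2_ker_normal i).
  rewrite /ext2_dom /= quotientY ?(subset_trans _ nZK) ?joing_subl //; last first.
    exact: subset_trans sBC (joing_subr _ _).
  rewrite abelianY !quotient_abelian //=; last first.
    exact: abelianS sBC (morphim_abelian _ abelian_C).
  by apply: quotient_cents2r; rewrite commGC; apply: ext2_centralise.
apply: dvd_pred_class => //.
  exact: sqf_dvd (cardG_gt0 _) (dvdYZ i) sqf_K.
by move=> p pr_p p_K; apply: prime_dvd_K => //; apply: dvdn_trans p_K (dvdYZ i).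
Qed.

Section ThirdStage.

Variables (hT2 : finGroupType) (V2 : {group hT2}) (s2 : {morphism K >-> hT2}).
Hypothesis ext2 : twisted_extension (@class_prime 2) ext2_dom ext2_ker V2 s2.

Local Notation E := (V2 <*> s2 @* K)%G.

Let prime_dvd_V2 p : prime p -> (p %| #|V2|)%N -> exists2 t, col t = 2%N & p = r t.
Proof.
move=> pr_p /(prime_dvd_split_kernel (@class_prime_pr 2) ext2 pr_p)[i ->].
by exists (val i) => //; apply/eqP/(valP i).
Qed.

Let r'V2 t : (col t < 2)%N -> ~~ (r t %| #|V2|)%N.
Proof. by move=> lt_t; apply/negP=> /(prime_dvd_V2 (pr_r t))[u cu /r_inj tu]; rewrite tu cu in lt_t. Qed.

Let r'V1 t : col t != 1%N -> ~~ (r t %| #|V1|)%N.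
Proof. by move=> neq_t; apply/negP=> /(prime_dvd_V1 (pr_r t))[u cu /r_inj tu]; rewrite tu cu in neq_t. Qed.

Let r'C t : (0 < col t)%N -> ~~ (r t %| #|C|)%N.
Proof. by move=> lt_t; apply/negP=> /(prime_dvd_C (pr_r t))[u cu /r_inj tu]; rewrite tu leqNgt cu in lt_t. Qed.

Lemma prime_dvd_construction p : prime p -> (p %| #|E|)%N -> exists t, p = r t.
Proof.
move=> pr_p /(prime_dvd_split_extension (@class_prime_pr 2) ext2 pr_p)[[i ->]|].
  by exists (val i).
by case/(prime_dvd_K pr_p)=> t _; exists t.
Qed.

Lemma construction_sol : solvable E.
Proof.
apply: (split_extension_sol ext2); apply: (split_extension_sol ext1).
exact: abelian_sol.
Qed.

Let base_elt o : col o = 0%N -> exists2 x, x \in C & #[x] = r o.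
Proof.
move=> co; have r_C : (r o %| #|C|)%N by rewrite dvd_C //; apply/existsP; exists o; rewrite co !eqxx.
by have [x Cx ox] := Cauchy (pr_r o) r_C; exists x.
Qed.

Let class_elt k t (ct : col t == k) : colour_class k := exist _ t ct.

Let s1K x : x \in C -> s1 x \in K.
Proof. by move=> Cx; rewrite mem_gen // inE mem_morphim ?orbT. Qed.

Let V1K v : v \in V1 -> v \in K.
Proof. by move=> Vv; rewrite mem_gen // inE Vv. Qed.

Let s2E x : x \in K -> s2 x \in E.
Proof. by move=> Kx; rewrite mem_gen // inE mem_morphim ?orbT. Qed.

Let V2E v : v \in V2 -> v \in E.
Proof. by move=> Vv; rewrite mem_gen // inE Vv. Qed.

Let order_s1 x : x \in C -> #[s1 x] = #[x].
Proof. by move=> Cx; rewrite order_injm // (ext_inj ext1). Qed.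

Let order_s2 x : x \in K -> #[s2 x] = #[x].
Proof. by move=> Kx; rewrite order_injm // (ext_inj ext2). Qed.

Let kernel1_elt d : col d = 1%N -> exists2 v, v \in V1 & #[v] = r d.
Proof. by move/eqP=> cd; apply: (ext_order_exists ext1 (class_elt cd)). Qed.

(** Elements of [C] commute, and so do elements of [V1]; for an element of [C] and
    a vertex of colour 1, a fixed point in [V1] is needed. *)
Let K_elts t u : (col t <= col u)%N -> (col u < 2)%N -> t != u -> e t u ->
  exists x y, [/\ x \in K, y \in K, #[x] = r t, #[y] = r u & commute x y].
Proof.
move=> le_tu lt_u neq_tu e_tu; case cu: (col u) le_tu lt_u => [|[|//]] //.
  rewrite leqn0 => /eqP ct _.
  have [[x Cx ox] [y Cy oy]] := (base_elt ct, base_elt cu).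
  exists (s1 x), (s1 y); rewrite !order_s1 // !s1K //; split=> //.
  by red; rewrite -!morphM // (centsP abelian_C).
case ct: (col t) => [|[|//]] // _ _.
  have [x Cx ox] := base_elt ct; have /eqP cu' := cu.
  have [||v [Vv ov cvx]] := ext_fixed_exists ext1 (j := class_elt cu') Cx.
  - by rewrite ox.
  - by rewrite (mem_pcore_abelian _ abelian_C Cx ox) // mem_class_primes // e_sym e_tu orbT.
  by exists (s1 x), v; rewrite order_s1 // s1K // V1K //; split=> //; apply: commute_sym.
have [[v Vv ov] [w Vw ow]] := (kernel1_elt ct, kernel1_elt cu).
by exists v, w; rewrite !V1K //; split=> //; apply: (centsP abV1).
Qed.

Lemma construction_vertex t : exists2 x, x \in E & #[x] = r t.
Proof.
case ct: (col t) (col_lt3 t) => [|[|[|//]]] _.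
- have [x Cx ox] := base_elt ct; exists (s2 (s1 x)); first by rewrite s2E ?s1K.
  by rewrite order_s2 ?s1K // order_s1.
- have [v Vv ov] := kernel1_elt ct; exists (s2 v); first by rewrite s2E ?V1K.
  by rewrite order_s2 ?V1K.
move/eqP: ct => ct; have [v Vv ov] := ext_order_exists ext2 (class_elt ct).
by exists v; first exact: V2E.
Qed.

(** If [u] has colour 2 and [t] does not, some element of order [r t] is outside
    [ext2_dom] or inside [ext2_ker], and thus has a fixed point of order [r u]. *)
Lemma construction_elts t u : (col t <= col u)%N -> t != u -> e t u ->
  exists x y, [/\ x \in E, y \in E, #[x] = r t, #[y] = r u & commute x y].
Proof.
move=> le_tu neq_tu e_tu; have [lt_u | ge_u] := ltnP (col u) 2.
  have [x [y [Kx Ky ox oy cxy]]] := K_elts le_tu lt_u neq_tu e_tu.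
  exists (s2 x), (s2 y); rewrite !order_s2 // !s2E //; split=> //.
  by red; rewrite -!morphM // cxy.
have cu : col u == 2%N by rewrite eqn_leq ge_u -ltnS col_lt3.
pose i := class_elt cu.
have [ct | ct] := boolP (col t == 2%N).
  have [v Vv ov] := ext_order_exists ext2 (class_elt ct).
  have [w Vw ow] := ext_order_exists ext2 i.
  by exists v, w; rewrite !V2E //; split=> //; apply: (centsP (ext_abelian ext2)).
have [x Kx [ox YZx]] : exists2 x, x \in K & #[x] = r t /\ (x \notin ext2_dom i) || (x \in ext2_ker i).
  case ct0: (col t) ct le_tu (col_lt3 t) => [|[|[|//]]] // _ _ _.
    have [x Cx ox] := base_elt ct0; exists (s1 x); first exact: s1K.
    rewrite order_s1 //; split=> //; apply/orP; left; apply/negP=> /order_dvdG.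
    rewrite order_s1 // ox (card_split_extension_sub ext1) ?pcore_sub // Euclid_dvdM //.
    rewrite (negPf (r'V1 _)) ?ct0 //=; apply/negP; rewrite -p'natE //.
    apply: sub_in_pnat (pcore_pgroup _ _) => p _ /existsP[o /and3P[_ not_eo /eqP->]].
    by rewrite !inE; apply: contraNneq not_eo => /r_inj->.
  have [v Vv ov] := kernel1_elt ct0; exists v; first exact: V1K.
  split=> //; apply/orP; right.
  by rewrite (mem_pcore_abelian _ abV1 Vv ov) // mem_class_primes // e_sym.
have [|v [Vv ov cvx]] := ext_fixed_exists ext2 (j := i) Kx _ YZx; first by rewrite ox.
by exists (s2 x), v; rewrite order_s2 // s2E // V2E //; split=> //; apply: commute_sym.
Qed.

Let dom2_order t (i : colour_class 2) : (col t < 2)%N -> ~~ e t (val i) ->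
  forall x, x \in K -> #[x] = r t -> (x \in ext2_dom i) && (x \notin ext2_ker i).
Proof.
move=> lt_t not_e x Kx ox; have sV1Y : V1 \subset ext2_dom i := joing_subl _ _.
have sZV1 : ext2_ker i \subset V1 := pcore_sub _ _.
case ct: (col t) lt_t => [|[|//]] _.
  have r'V : ~~ (r t %| #|V1|)%N by rewrite r'V1 ?ct.
  apply/andP; split; last first.
    by apply: contra r'V => /(subsetP sZV1)/order_dvdG; rewrite ox.
  have [g Kg [z [Cz oz Dxg]]] := split_extension_order_conj ext1 (pr_r t) r'V Kx ox.
  rewrite -(memJ_norm x (subsetP (normal_norm (ext2_dom_normal i)) g Kg)) Dxg.
  rewrite mem_gen // inE mem_morphim ?orbT // (mem_pcore_abelian _ abelian_C Cz oz) //.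
  by rewrite mem_class_primes.
have Vx : x \in V1.
  apply: (mem_normal_coprime_index nsV1K Kx); rewrite ox prime_coprime //.
  by rewrite -divgS ?normal_sub // card_K mulKn ?cardG_gt0 // r'C // ct.
rewrite (subsetP sV1Y) //= (mem_pcore_abelian _ abV1 Vx ox) //.
by rewrite mem_class_primes // e_sym.
Qed.

Let kernel1_card (d : colour_class 1) : #|'O_(class_prime d)(V1)| = class_prime d.
Proof.
apply/eqP; rewrite eqn_leq (split_kernel_core_prime (@class_prime_pr 1) (@class_prime_inj 1) ext1) //=.
have [v Vv ov] := ext_order_exists ext1 d; rewrite -{1}ov dvdn_leq ?cardG_gt0 //.
by rewrite order_dvdG // (mem_pcore_abelian _ abV1 Vv ov) // !inE.
Qed.

(** The colours of [t] and [u] differ. If one of them is 2, the Sylow subgroup of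
    [V2] for this vertex is normal, and the elements whose order is the prime of
    the other vertex act on it without fixed points. Otherwise the same holds
    modulo [V2] for the Sylow subgroup of [V1]. *)
Lemma construction_nonadjacent t u (k : Iirr E) : complement e t u ->
  ~~ ((r t %| codegree 'chi_k)%C && (r u %| codegree 'chi_k)%C).
Proof.
wlog lt_tu : t u / (col t < col u)%N => [wlog_lt | /andP[_ not_e]].
  move=> tu; have [|lt_ut|] := ltngtP (col t) (col u); first by move/wlog_lt; apply.
    rewrite andbC; apply: wlog_lt => //.
    by move: tu; rewrite /complement /= eq_sym e_sym.
  by move/eqP; rewrite (negPf (proper tu)).
case/orP: (leqVgt 2 (col u)) => [cu2 | cu1].
  have cu : col u == 2%N by rewrite eqn_leq cu2 -ltnS col_lt3.
  pose i := class_elt cu; have lt_t : (col t < 2)%N by rewrite -(eqP cu).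
  apply: (split_extension_nonadjacent (@class_prime_pr 2) (@class_prime_inj 2) ext2 (j := i)).
  - exact: pr_r.
  - exact: r'V2.
  - exact: (class_prime_ndvd i prime_dvd_K).
  exact: dom2_order.
have cu : col u == 1%N by rewrite eqn_leq -ltnS cu1 (leq_ltn_trans _ lt_tu).
have ct : col t = 0%N by move: lt_tu; rewrite (eqP cu) ltnS leqn0 => /eqP.
pose d := class_elt cu; pose Q := 'O_(class_prime d)(V1)%G.
have nsQK : Q <| K by apply: gFnormal_trans nsV1K.
apply: (split_extension_section_nonadjacent ext2 (Q := Q)) => //.
- by rewrite r'V2 ?ct.
- by rewrite r'V2 ?(eqP cu).
- exact: kernel1_card.
- apply/negP=> r_iQ; have := sqf_K (r u); apply/negP; rewrite -ltnNge.
  rewrite -(Lagrange (normal_sub nsQK)) lognM ?cardG_gt0 ?indexg_gt0 // kernel1_card.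
  by rewrite logn_prime // eqxx ltnS logn_gt0 mem_primes pr_r indexg_gt0.
apply: (split_extension_regular (@class_prime_pr 1) (@class_prime_inj 1) ext1).
- exact: pr_r.
- by rewrite r'V1 ?ct.
move=> x Cx ox; rewrite Cx (mem_pcore_abelian _ abelian_C Cx ox) //.
by rewrite mem_class_primes // e_sym.
Qed.

End ThirdStage.

End SecondStage.

End Construction.

(** * The characterisation of codegree graphs *)

(** The prime divisors of the order of the group constructed above are the primes
    [r t], and these are orders of elements, so that they are the vertices of
    the codegree graph. *)
Lemma cod_graph_exists (T : finType) (e : rel T) :
    symmetric e -> irreflexive e ->
    colorable 3 (complement e) -> triangle_free (complement e) ->
  exists (gT : finGroupType) (G : {group gT}), solvable G /\ graph_iso e (@cod_graph gT G).
Proof.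
move=> e_sym e_irr [c proper] tri; pose col t : nat := c t.
have proper_col t u : complement e t u -> col t != col u by apply: proper.
have col_lt3 t : (col t < 3)%N := ltn_ord (c t).
have [r [pr_r r_inj] r_mod] := coloured_primes col.
have [hT1 [V1 [s1 ext1]]] := ext1_exists e pr_r r_inj r_mod.
have [hT2 [V2 [s2 ext2]]] := ext2_exists e_sym tri pr_r r_inj r_mod ext1.
set G := (V2 <*> s2 @* (V1 <*> s1 @* base_group col r))%G.
have elt t : exists2 x, x \in G & #[x]%g = r t.
  exact: (construction_vertex col_lt3 pr_r ext1 ext2).
have vertexP t : cod_vertex G (r t).
  have [x Gx ox] := elt t; rewrite /cod_vertex pr_r.
  have [i r_i] := codegree_prime_order (pr_r t) Gx ox.
  by apply/hasP; exists (codegree 'chi_i); rewrite ?map_f ?mem_irr.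
have vertex_ex (p : {p : nat | cod_vertex G p}) : exists t, val p == r t.
  have [pr_p p_G] := cod_vertex_dvd (valP p).
  have [t ->] := prime_dvd_construction pr_r ext1 ext2 pr_p p_G.
  by exists t.
have solG : solvable G by exact: (construction_sol ext1 ext2).
exists hT2, G; split; first exact: solG.
exists (fun t => exist _ (r t) (vertexP t)).
  exists (fun p => xchoose (vertex_ex p)) => [t | p].
    by apply: r_inj; rewrite -(eqP (xchooseP (vertex_ex _))).
  by apply: val_inj; rewrite /= -(eqP (xchooseP (vertex_ex p))).
move=> t u; rewrite /cod_graph /= (inj_eq r_inj).
have [-> | neq_tu] /= := eqVneq t u; first by rewrite e_irr.
have [e_tu | not_e] := boolP (e t u).
  wlog le_tu : t u neq_tu e_tu / (col t <= col u)%N => [wlog_le|].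
    have [/wlog_le|/ltnW/wlog_le] := leqP (col t) (col u); first exact.
    by rewrite eq_sym e_sym mulnC; apply.
  have [x [y [Gx Gy ox oy cxy]]] := construction_elts e_sym col_lt3 pr_r r_inj ext1 ext2 le_tu neq_tu e_tu.
  have neq_r : r t != r u by rewrite (inj_eq r_inj).
  have [i ri] := codegree_prime_orders (pr_r t) (pr_r u) neq_r Gx Gy cxy ox oy.
  by apply/hasP; exists (codegree 'chi_i); rewrite ?map_f ?mem_irr.
apply/hasPn=> _ /mapP[_ /irrP[i ->] ->].
rewrite dvdC_codegree_mul ?(inj_eq r_inj) //.
apply: (construction_nonadjacent e_sym proper_col col_lt3 pr_r r_inj ext1 ext2).
by rewrite /complement /= neq_tu.
Qed.

Theorem proposition3p5 (T : finType) (e : rel T)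
    (e_sym : symmetric e) (e_irr : irreflexive e) :
  (exists (gT : finGroupType) (G : {group gT}),
     solvable G /\ graph_iso e (@cod_graph gT G))
  <-> (colorable 3 (complement e) /\ triangle_free (complement e)).
Proof.
split=> [[gT [G [solG iso_e]]] | [col3 tri]]; first exact: cod_graph_complement iso_e.
exact: cod_graph_exists.
Qed.
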